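(* For every stable roommates instance $(G=(V,E),>)$ with $G$ a finite simple graph and a strict preference order $>_v$ on $N(v)$ for each $v\in V$, the Vertex Deletion Algorithm (described in the context) runs in polynomial time and finds a smallest removable set, i.e. the set $S\subseteq V$ it returns is a removable set of minimum cardinality.
   Context: A stable roommates instance is a pair $(G,>)$ where $G=(V,E)$ is a finite simple undirected graph and, for each $u\in V$, $>_u$ is a strict linear order on the set of neighbours $N(u)$ (each vertex prefers any neighbour to being unmatched). For a matching $M\subseteq E$, an edge $uv\in E\setminus M$ is blocking if $u$ is unmatched in $M$ or prefers $v$ to its partner in $M$, and $v$ is unmatched in $M$ or prefers $u$ to its partner in $M$. $M$ is stable if there is no blocking edge. A set $S\subseteq V$ is removable if $G-S$ (with the preferences restricted) admits a stable matching. A stable partition of $(G,>)$ is a permutation $\pi\colon V\to V$ such that for each $u\in V$: (i) if $\pi(u)\neq u$ then $u\pi(u),u\pi^{-1}(u)\in E$, and if moreover $\pi(u)\ne\pi^{-1}(u)$ then $\pi(u)>_u\pi^{-1}(u)$; (ii) for each $v\in N(u)$ with $v\ne \pi(u)$, if $\pi(u)=u$ or $v>_u\pi^{-1}(u)$, then $\pi(v)\neq v$ and $\pi^{-1}(v)>_v u$. By a theorem of Tan (known), every stable roommates instance admits a stable partition, one can be found in $\mathcal{O}(|V|^2)$ time, and all stable partitions have the same fixed points and the same odd cycles. Vertex Deletion Algorithm. Start with $S=\emptyset$, $M=\emptyset$. Find a stable partition $\pi$ using Tan's algorithm. For each cycle of $\pi$ of odd length at least $3$, with vertices $v_0,v_1,\dots,v_t$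 ($t$ even, $\pi(v_j)=v_{j+1}$ for $j<t$, $\pi(v_t)=v_0$, where the starting vertex $v_0$ of the cycle is chosen arbitrarily), add $v_0$ to $S$ and add the edges $v_{2j-1}v_{2j}$, $1\le j\le t/2$, to $M$. For each cycle of $\pi$ of even length, with vertices $v_0,\dots,v_t$ ($t$ odd, labelled in the same way), add the edges $v_{2j-2}v_{2j-1}$, $1\le j\le (t+1)/2$, to $M$. Return $S$ and $M$. *)

(* Defs.v *)
From mathcomp Require Import all_boot all_fingroup.

Set Implicit Arguments.
Unset Strict Implicit.
Unset Printing Implicit Defensive.

(* [pref u v w] is v >_u w; its values are unconstrained, and irrelevant, unless
   v and w are neighbours of u. *)
Record roommates (V : finType) := Roommates {
  adj : rel V;
  pref : V -> rel V;
  adj_sym : symmetric adj;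
  adj_irr : irreflexive adj;
  pref_irr : forall u, {in adj u, irreflexive (pref u)};
  pref_trans : forall u, {in adj u & &, transitive (pref u)};
  pref_total : forall u,
    {in adj u &, forall v w, v != w -> pref u v w || pref u w v} }.

Section Instance.
Variables (V : finType) (I : roommates V).

Definition edges : {set {set V}} :=
  [set e | [exists u, exists v, adj I u v && (e == [set u; v])]].

Definition matching (M : {set {set V}}) : bool :=
  (M \subset edges) && trivIset M.

Definition unmatched_or_prefers (M : {set {set V}}) (u v : V) : bool :=
  (u \notin cover M) || [exists w, ([set u; w] \in M) && pref I u v w].

Definition blocking (M : {set {set V}}) (u v : V) : bool :=
  [&& adj I u v, [set u; v] \notin M,
      unmatched_or_prefers M u v & unmatched_or_prefers M v u].

Definition stable_matching (M : {set {set V}}) : Prop :=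
  matching M /\ forall u v, ~~ blocking M u v.

Section Deletion.
Variable S : {set V}.
Let W : finType := {x : V | x \notin S}.
Let del_adj : rel W := fun u v => adj I (val u) (val v).
Let del_pref (u : W) : rel W := fun v w => pref I (val u) (val v) (val w).

Fact del_adj_sym : symmetric del_adj.
Proof. by move=> u v; apply: adj_sym. Qed.
Fact del_adj_irr : irreflexive del_adj.
Proof. by move=> u; apply: adj_irr. Qed.
Fact del_pref_irr u : {in del_adj u, irreflexive (del_pref u)}.
Proof. by move=> v uv; apply: pref_irr. Qed.
Fact del_pref_trans u : {in del_adj u & &, transitive (del_pref u)}.
Proof. by move=> v w x uv uw ux; apply: pref_trans. Qed.
Fact del_pref_total u :
  {in del_adj u &, forall v w, v != w -> del_pref u v w || del_pref u w v}.
Proof. by move=> v w uv uw vw; apply: pref_total. Qed.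

(* G - S on the vertex set V \ S, with the restricted preferences. *)
Definition delete : roommates {x : V | x \notin S} :=
  Roommates del_adj_sym del_adj_irr del_pref_irr del_pref_trans del_pref_total.
End Deletion.

Definition stable_partition (pi : {perm V}) : Prop :=
  let inv := (pi^-1)%g in
  (forall u,
     pi u != u ->
     [/\ adj I u (pi u), adj I u (inv u)
       & pi u != inv u -> pref I u (pi u) (inv u)]) /\
  (forall u v,
     adj I u v -> v != pi u -> (pi u == u) || pref I u v (inv u) ->
     pi v != v /\ pref I v (inv v) u).
End Instance.

Definition removable (V : finType) (I : roommates V) (S : {set V}) : Prop :=
  exists M, stable_matching (delete I S) M.

Definition smallest_removable (V : finType) (I : roommates V) (S : {set V}) :
    Prop :=
  removable I S /\ forall S' : {set V}, removable I S' -> #|S| <= #|S'|.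

(* Running time is counted on a random-access machine whose arrays are indexed
   by V: [tick] charges one unit for each elementary operation (an adjacency or
   preference query, an equality test, reading or writing one array or list
   cell), and every loop iteration over a list costs one more unit.  Sets and
   tables are updated in place, one cell at a time. *)
Record timed (A : Type) := Timed { value : A; time : nat }.

Definition ret A (a : A) : timed A := Timed a 0.
Definition ticks n A (a : A) : timed A := Timed a n.
Definition tick A (a : A) : timed A := ticks 1 a.
Definition bind A B (m : timed A) (f : A -> timed B) : timed B :=
  let: Timed a s := m in let: Timed b t := f a in Timed b (s + t).

Notation "'let!' x := m 'in' k" := (bind m (fun x => k))
  (at level 200, x name, m at level 100, k at level 200).

Fixpoint for_each X A (s : seq X) (body : X -> A -> timed A) (a : A) : timed A :=
  if s is x :: s' then
    let! b := body x a in
    let! b := tick b in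
    for_each s' body b
  else ret a.

Section Algorithms.
Variables (V : finType) (I : roommates V).

(* Tan's algorithm.  The table holds (u, v) when v is still on the list of u.
   First the proposals reduce the table, then rotations are eliminated until
   every list has at most two entries; at that point mapping each u to the first
   entry of its list, or to u itself if the list is empty, is a stable
   partition. *)
Definition table := {set V * V}.

Definition full_table : timed table :=
  for_each (enum V) (fun u =>
    for_each (enum V) (fun v (T : table) =>
      let! uv := tick (adj I u v) in
      if uv then tick ((u, v) |: T) else ret T)) set0.

Fixpoint insert (u v : V) (s : seq V) : timed (seq V) :=
  if s is w :: s' then
    let! vw := tick (pref I u v w) in
    if vw then tick (v :: s) else let! t := insert u v s' in tick (w :: t)
  else tick [:: v].

Definition row (T : table) (u : V) : timed (seq V) :=
  for_each (enum V) (fun v s =>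
    let! uv := tick ((u, v) \in T) in
    if uv then insert u v s else ret s) [::].

Definition last_entry (x : V) (s : seq V) : timed V :=
  ticks (size s) (last x s).

Definition truncate (y x : V) (T : table) : timed table :=
  for_each (enum V) (fun z (T : table) =>
    let! yz := tick ((y, z) \in T) in
    let! xz := tick (pref I y x z) in
    if yz && xz then ticks 2 (T :\ (y, z) :\ (z, y)) else ret T) T.

(* Repeats [body] #|V| ^ 2 times, an upper bound for the number of useful
   rounds, since each useful round deletes an entry of the table. *)
Definition rounds (body : table -> timed table) (T : table) : timed table :=
  for_each (enum V) (fun _ => for_each (enum V) (fun _ => body)) T.

Definition propose (T : table) : timed table :=
  for_each (enum V) (fun x (T : table) =>
    let! s := row T x in
    if s is y :: _ then truncate y x T else ret T) T.

Definition second_entry (T : table) (x : V) : timed V :=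
  let! s := row T x in tick (nth x s 1).

Definition next (T : table) (x : V) : timed V :=
  let! y := second_entry T x in
  let! s := row T y in
  last_entry x s.

Definition find_long (T : table) : timed (option V) :=
  for_each (enum V) (fun u o =>
    let! s := row T u in
    let! n := ticks (size s) (size s) in
    if 2 < n then tick (Some u) else ret o) None.

(* The cycle r, f r, f (f r), ... up to the first return to r; [n] only serves
   to make the recursion structural, and n = #|V| suffices. *)
Fixpoint walk (f : V -> timed V) (r x : V) (n : nat) : timed (seq V) :=
  if n is n'.+1 then
    let! stop := tick (x == r) in
    if stop then ret [::]
    else let! y := f x in
         let! s := walk f r y n' in
         tick (x :: s)
  else ret [::].

Definition cycle_from (f : V -> timed V) (r : V) : timed (seq V) :=
  let! x := f r in
  let! s := walk f r x #|V| in
  tick (r :: s).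

Definition eliminate (T : table) : timed table :=
  let! o := find_long T in
  if o is Some u then
    let! r := for_each (enum V) (fun _ => next T) u in
    let! xs := cycle_from (next T) r in
    let! ps := for_each xs (fun x ps =>
      let! y := second_entry T x in tick ((x, y) :: ps)) [::] in
    for_each ps (fun p => truncate p.2 p.1) T
  else ret T.

Definition first_entries (T : table) : timed {ffun V -> V} :=
  let! f := ticks #|V| [ffun v => v] in
  for_each (enum V) (fun u (f : {ffun V -> V}) =>
    let! s := row T u in
    tick [ffun v => if v == u then head u s else f v]) f.

(* [insubd] views the array as a permutation; it would give the identity on a
   non-injective array. *)
Definition tan : timed {perm V} :=
  let! T := full_table in
  let! T := rounds propose T in
  let! T := rounds eliminate T in
  let! f := first_entries T in
  ret (insubd (1%g : {perm V}) f).

Fixpoint pair_up (s : seq V) (M : {set {set V}}) : timed {set {set V}} :=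
  match s with
  | a :: b :: s' => let! M := tick ([set a; b] |: M) in pair_up s' M
  | _ => ret M
  end.

(* [find] computes a stable partition.  [start] models the arbitrary choice of
   the starting vertices: once a cycle has been listed as c, its vertex v_0 is
   the one at position [start c], or the head of c if there is no such
   position.  In the pair returned, the first component is the set of deleted
   vertices and the second one the matching. *)
Definition vertex_deletion (find : timed {perm V}) (start : seq V -> nat) :
    timed ({set V} * {set {set V}}) :=
  let! pi := find in
  let step x := tick (pi x) in
  let! out := for_each (enum V)
    (fun x (st : {set V} * {set V} * {set {set V}}) =>
      let: (seen, D, M) := st in
      let! old := tick (x \in seen) in
      if old then ret st else
      let! c := cycle_from step x in
      let! v0 := ticks (size c) (nth x c (start c)) in
      let! c := cycle_from step v0 in
      let! seen := for_each c (fun y (seen : {set V}) => tick (y |: seen)) seen in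
      let! n := ticks (size c) (size c) in
      if odd n then
        if 2 < n then
          let! D := tick (v0 |: D) in
          let! M := pair_up (behead c) M in
          ret (seen, D, M)
        else ret (seen, D, M)
      else
        let! M := pair_up c M in
        ret (seen, D, M)) (set0, set0, set0) in
  let: (_, D, M) := out in ret (D, M).
End Algorithms.

Definition finder := forall V : finType, roommates V -> timed {perm V}.

Definition finds_stable_partitions (find : finder) : Prop :=
  forall (V : finType) (I : roommates V), stable_partition I (value (find V I)).

Definition finder_polynomial_time (find : finder) : Prop :=
  exists c k, forall (V : finType) (I : roommates V),
    time (find V I) <= c * #|V| ^ k + c.

Definition vertex_deletion_correct (find : finder) : Prop :=
  forall (V : finType) (I : roommates V) (start : seq V -> nat),
    smallest_removable I (value (vertex_deletion (find V I) start)).1.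

Definition vertex_deletion_polynomial_time (find : finder) : Prop :=
  exists c k, forall (V : finType) (I : roommates V) (start : seq V -> nat),
    time (vertex_deletion (find V I) start) <= c * #|V| ^ k + c.

(* Main.v *)
(** Call [pi] a stable partition and [mu] a stable matching of [G - S'].  Let [low]
    be the vertices outside [S'] that are worse off in [mu] than with [pi^-1 u],
    and [high] those that are better off, their partner not being [pi u].
    Stability of [pi] makes [mu] an injection from [high] to [low], and stability
    of [mu] puts [pi^-1 w] in [S'] or [high] for each [w] in [low].  So the vertices
    of [S' :|: high] that are not of the form [pi^-1 w], with [w] in [low], number
    at most [#|S'|].  A nontrivial cycle of [pi] without such a vertex is
    partitioned into pairs [{pi^-1 w, w}], with [w] in [low], and pairs of [mu],
    hence is even: there are at most [#|S'|] odd cycles of length at least 3, and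
    the algorithm deletes one vertex from each of them.

    In Tan's algorithm, the table satisfies two conditions from the end of the
    proposals on: the last entry
    of the list of the first entry of [x] is [x], and for each edge that has left
    the table, one end prefers its whole list, which is not empty, to the other
    end.  They characterise stable partitions once the lists have length at most
    2.  The delicate point is that a rotation reached from a list of length at
    least 3 never empties a list: one that did would be an odd cycle of lists of
    length 2, which cannot be entered from outside. *)

Require Import Defs.
From mathcomp Require Import all_boot all_fingroup zify.

Set Implicit Arguments.
Unset Strict Implicit.
Unset Printing Implicit Defensive.

Local Arguments bind : simpl never.

(** * Values and costs of timed computations *)

Lemma value_bind A B (m : timed A) (f : A -> timed B) :
  value (bind m f) = value (f (value m)).
Proof. by rewrite /bind; case: m => a s /=; case: (f a). Qed.

Lemma time_bind A B (m : timed A) (f : A -> timed B) :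
  time (bind m f) = time m + time (f (value m)).
Proof. by rewrite /bind; case: m => a s /=; case: (f a). Qed.

Lemma value_for_each X A (s : seq X) (body : X -> A -> timed A) a :
  value (for_each s body a) = foldl (fun a x => value (body x a)) a s.
Proof. by elim: s a => //= x s IHs a; rewrite !value_bind /= IHs. Qed.

Lemma value_if A (b : bool) (m m' : timed A) :
  value (if b then m else m') = if b then value m else value m'.
Proof. by case: b. Qed.

Definition valueE := (value_bind, value_for_each, value_if).

Lemma foldl_const X A (f : A -> A) (s : seq X) a :
  foldl (fun a _ => f a) a s = iter (size s) f a.
Proof. by elim: s a => //= x s IHs a; rewrite IHs -iterSr. Qed.

(** Any exponent can be reduced modulo the period [m], which need not be the least one. *)
Lemma cyclic_trajectP (T : eqType) (g : T -> T) r m x :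
  0 < m -> iter m g r = r ->
  reflect (exists i, x = iter i g r) (x \in traject g r m).
Proof.
move=> m_gt0 iter_m; apply: (iffP trajectP) => [[i _ ->]|[i ->]]; first by exists i.
exists (i %% m); first by rewrite ltn_mod.
rewrite {1}(divn_eq i m) addnC iterD; congr iter.
by elim: (i %/ m) => // k IHk; rewrite mulSn addnC iterD iter_m.
Qed.

(** * Cycles found by iterating a map *)

Section Cycle.
Variables (V : finType) (f : V -> timed V).
Let g x := value (f x).

Lemma value_walk r x n m :
  m < n -> iter m g x = r -> (forall i, i < m -> iter i g x != r) ->
  value (walk f r x n) = traject g x m.
Proof.
elim: n m x => // n IHn [|m] x /= ltmn gx minm; rewrite !valueE /=.
  by rewrite gx eqxx.
rewrite (negbTE (minm 0 _)) //= (IHn m) //; first by rewrite -iterSr.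
by move=> i lti; rewrite -/(g x) -iterSr; apply: minm.
Qed.

(** The least period [m] makes the entries distinct, hence [m <= #|V|], so the recursion bound of
    [walk] never cuts the cycle short. *)
Lemma value_cycle_from r :
  (exists2 k, 0 < k & iter k g r = r) ->
  exists m, [/\ 0 < m, iter m g r = r, uniq (traject g r m)
             & value (cycle_from f r) = traject g r m].
Proof.
move=> exk.
have ex: exists k, (0 < k) && (iter k g r == r).
  by case: exk => k k0 /eqP gk; exists k; rewrite k0.
case: (ex_minnP ex) => m /andP[m_gt0 /eqP gm] minm.
have iter_neq i : 0 < i -> i < m -> iter i g r != r.
  by move=> i0 lti; apply: contraL lti => gi; rewrite -leqNgt minm ?i0.
have uniq_m : uniq (traject g r m).
  case: m m_gt0 gm {minm} iter_neq => // m _ gm iter_neq.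
  rewrite looping_uniq; apply/negP => /trajectP[i lti eqi].
  by have := iter_neq i.+1 isT lti; rewrite /= -eqi -iterS gm eqxx.
exists m; split=> //; case: m m_gt0 gm iter_neq uniq_m minm => // m _ gm iter_neq um _.
rewrite /cycle_from !valueE /= (value_walk (m := m)) //.
- by have := max_card (mem (traject g r m.+1)); rewrite (card_uniqP um) size_traject.
- by rewrite -iterSr.
- by move=> i lti; rewrite -/(g r) -iterSr; apply: iter_neq.
Qed.
End Cycle.

(** * Preference tables and their sorted rows *)

Section Tables.
Variables (V : finType) (I : roommates V).
Implicit Types (T : {set V * V}) (s : seq V).

Lemma pref_asym u v w :
  adj I u v -> adj I u w -> pref I u v w -> pref I u w v -> False.
Proof.
move=> uv uw vw wv; have := pref_trans uw uv uv vw wv.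
by rewrite (pref_irr uv).
Qed.

Lemma pref_neq u v w : adj I u v -> pref I u v w -> v != w.
Proof. by move=> uv; apply: contraTneq => <-; rewrite (pref_irr uv). Qed.

Lemma mem_insert u v s : value (insert I u v s) =i v :: s.
Proof.
elim: s => //= w s IHs x; rewrite !valueE /=; case: ifP => // _.
by rewrite inE IHs !inE orbCA.
Qed.

Lemma pairwise_insert u v s :
  adj I u v -> {in s, forall w, adj I u w} -> v \notin s ->
  pairwise (pref I u) s -> pairwise (pref I u) (value (insert I u v s)).
Proof.
move=> uv; elim: s => //= w s IHs us; rewrite inE negb_or => /andP[vw vs].
case/andP=> ws ps; rewrite !valueE /=.
have uw : adj I u w by apply: us; rewrite mem_head.
have us' : {in s, forall x, adj I u x} by move=> x xs; apply: us; rewrite inE xs orbT.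
case: ifP => [pvw|npvw] /=.
  rewrite pvw ws ps !andbT /=; apply/allP => x xs.
  by apply: (@pref_trans _ I u w v x) => //; [apply: us' | apply: (allP ws)].
rewrite IHs // andbT; apply/allP => x; rewrite mem_insert inE.
case/predU1P => [->|xs]; last exact: (allP ws).
by have := pref_total uv uw vw; rewrite npvw.
Qed.

Definition subtable T :=
  (forall u v, (u, v) \in T -> adj I u v) /\
  (forall u v, (u, v) \in T -> (v, u) \in T).

Section Rows.
Variable T : {set V * V}.
Hypothesis Tadj : forall u v, (u, v) \in T -> adj I u v.

Lemma row_spec u :
  (forall v, (v \in value (row I T u)) = ((u, v) \in T)) /\
  pairwise (pref I u) (value (row I T u)).
Proof.
rewrite /row value_for_each.
have loop l s : uniq l -> {in s, forall v, v \notin l} ->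
    {in s, forall v, adj I u v} -> pairwise (pref I u) s ->
  let r := foldl (fun s v => value (let! uv := tick ((u, v) \in T) in
             if uv then insert I u v s else ret s)) s l in
  (forall v, (v \in r) = (v \in s) || (v \in l) && ((u, v) \in T))
    /\ pairwise (pref I u) r.
  elim: l s => [|x l IHl] s /=; first by move=> _ _ _ ps; split=> // v; rewrite orbF.
  case/andP=> xl ul sl us ps; rewrite !valueE /=.
  have sl' : {in s, forall v, v \notin l}.
    by move=> v /sl; rewrite inE negb_or => /andP[].
  have xs : x \notin s by apply/negP => /sl; rewrite mem_head.
  case: ifP => xT /=.
    have ux := Tadj xT.
    case: (IHl (value (insert I u x s)) ul).
    - by move=> v; rewrite mem_insert inE => /predU1P[->|/sl'].
    - by move=> v; rewrite mem_insert inE => /predU1P[->|/us].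
    - exact: pairwise_insert.
    move=> memr pr; split=> // v; rewrite memr mem_insert !inE.
    by case: eqP => [->|]; rewrite /= ?xT ?orbT.
  case: (IHl s ul) => // memr pr; split=> // v; rewrite memr inE.
  by case: eqP => [->|] //=; rewrite xT andbF.
case: (loop (enum V) [::] (enum_uniq _)) => // memr pr; split=> // v.
by rewrite memr mem_enum.
Qed.

(** On an empty row all three default to [u], which is how fixed points of the final permutation
    arise. *)
Definition first_of u := head u (value (row I T u)).
Definition second_of u := nth u (value (row I T u)) 1.
Definition last_of u := last u (value (row I T u)).

Lemma first_ofP u v : (u, v) \in T ->
  (u, first_of u) \in T /\ (v = first_of u \/ pref I u (first_of u) v).
Proof.
case: (row_spec u) => mems ps uvT; rewrite -!mems in uvT *; rewrite /first_of.
case: (value _) ps uvT => //= y s /andP[/allP ys _].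
rewrite !inE eqxx; case/predU1P => [->|/ys]; by [split; auto].
Qed.

Lemma last_ofP u v : (u, v) \in T ->
  (u, last_of u) \in T /\ (v = last_of u \/ pref I u v (last_of u)).
Proof.
case: (row_spec u) => mems ps uvT; rewrite -!mems in uvT *; rewrite /last_of.
case: (value _) ps uvT => //= y s; elim: s y => [|z s IHs] y /=.
  by rewrite !inE eqxx => _ /eqP->; auto.
case/andP=> /andP[yz /allP ys] /IHs {}IHs; rewrite [last _ _ \in _]inE mem_last orbT inE.
case/predU1P=> [->|/IHs[_ ?]]; split=> //; right.
by have := mem_last z s; rewrite inE => /predU1P[->|/ys].
Qed.

Lemma first_of_uniq u v : (u, v) \in T ->
  (forall w, (u, w) \in T -> w = v \/ pref I u v w) -> first_of u = v.
Proof.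
move=> uv minv; case: (first_ofP uv) => uf [//|pf].
by case: (minv _ uf) => // vf; case: (pref_asym _ _ pf vf); apply: Tadj.
Qed.

Lemma last_of_uniq u v : (u, v) \in T ->
  (forall w, (u, w) \in T -> w = v \/ pref I u w v) -> last_of u = v.
Proof.
move=> uv minv; case: (last_ofP uv) => uf [//|pf].
by case: (minv _ uf) => // vf; case: (pref_asym _ _ pf vf); apply: Tadj.
Qed.

Lemma second_ofP u v : (u, v) \in T -> v != first_of u ->
  [/\ (u, second_of u) \in T, second_of u != first_of u
    & v = second_of u \/ pref I u (second_of u) v].
Proof.
case: (row_spec u) => mems; rewrite /second_of /first_of -!mems.
have uadj w : w \in value (row I T u) -> adj I u w by rewrite mems; apply: Tadj.
case: (value _) uadj => [|y [|z s]] //= uadj.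
  by rewrite inE => _ ->.
case/and3P=> /andP[yz _] /allP zs _; rewrite !inE eqxx orbT.
case/predU1P => [->|vzs _]; first by rewrite eqxx.
rewrite eq_sym (pref_neq _ yz) ?uadj ?mem_head //; split=> //.
by case/predU1P: vzs => [|/zs]; auto.
Qed.

Lemma row_size_gt2 u : 2 < size (value (row I T u)) ->
  exists v, [/\ (u, v) \in T, v != first_of u & v != second_of u].
Proof.
case: (row_spec u) => mems; rewrite /second_of /first_of.
have uadj w : w \in value (row I T u) -> adj I u w by rewrite mems; apply: Tadj.
move: mems uadj; case: (value _) => [|x [|y [|z s]]] //= mems uadj.
case/and3P=> /and3P[_ xz _] /andP[yz _] _ _; exists z.
rewrite -mems !inE eqxx !orbT; split=> //; rewrite eq_sym.
  by apply: pref_neq xz; rewrite uadj ?inE ?eqxx ?orbT.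
by apply: pref_neq yz; rewrite uadj ?inE ?eqxx ?orbT.
Qed.

Lemma row_size_le2 u v : size (value (row I T u)) <= 2 -> (u, v) \in T ->
  v = first_of u \/ v = last_of u.
Proof.
case: (row_spec u) => mems _; rewrite /last_of /first_of -mems.
by case: (value _) => [|x [|y [|z s]]] //= _; rewrite !inE;
   [move/eqP|case/orP=> /eqP]; auto.
Qed.

End Rows.
End Tables.

(** * Proposals *)

(** The loop only shrinks the set, so if it returns its input, every step was idle. *)
Lemma foldl_fixed (X : eqType) (Y : finType) (P : {set Y} -> Prop)
    (f : {set Y} -> X -> {set Y}) s T :
  (forall T x, P T -> P (f T x) /\ f T x \subset T) -> P T ->
  (P (foldl f T s) /\ foldl f T s \subset T) /\
  (foldl f T s = T -> {in s, forall x, f T x = T}).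
Proof.
move=> Pf; elim: s T => [|x s IHs] T PT /=; first by split.
have [PfT sfT] := Pf T x PT; have [[Pr sr] fixed] := IHs _ PfT.
split=> [|eqT]; first by split=> //; apply: subset_trans sfT.
have fT : f T x = T by apply/eqP; rewrite eqEsubset sfT -{1}eqT.
by move: fixed; rewrite fT in eqT * => /(_ eqT) fixed y /predU1P[->|/fixed].
Qed.

(** Each step that is not idle removes an element, so a fixed point is reached within [#|T|]
    steps. *)
Lemma iter_fixed (Y : finType) (P : {set Y} -> Prop) (f : {set Y} -> {set Y}) k T :
  (forall T, P T -> P (f T) /\ f T \subset T) -> P T -> #|T| <= k ->
  P (iter k f T) /\ f (iter k f T) = iter k f T.
Proof.
move=> Pf; elim: k T => [|k IHk] T PT.
  rewrite leqn0 cards_eq0 => /eqP T0; subst T; split=> //.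
  by apply/eqP; rewrite -subset0; case: (Pf _ PT).
rewrite iterSr => leT; have [PfT sfT] := Pf T PT.
have [fT|nfT] := eqVneq (f T) T; first by rewrite fT iter_fix.
apply: IHk => //; rewrite -ltnS (leq_trans _ leT) //; apply: proper_card.
by rewrite properEneq nfT.
Qed.

Section Tan.
Variables (V : finType) (I : roommates V).
Implicit Types (T : {set V * V}) (s : seq V).

Definition cut (y x : V) (p : V * V) :=
  (p.1 == y) && pref I y x p.2 || (p.2 == y) && pref I y x p.1.

(** The program tests only [(y, z)] before removing it and its mirror image; on a symmetric table
    this removes exactly the pairs of [cut y x]. *)
Lemma value_truncate y x T : subtable I T ->
  value (truncate I y x T) = [set p in T | ~~ cut y x p].
Proof.
case=> _ symT; rewrite /truncate value_for_each.
set body := fun T z => value _.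
suff loop s T0 : (forall u v, (u, v) \in T0 -> (v, u) \in T0) ->
    forall a b, ((a, b) \in foldl body T0 s) =
      [&& (a, b) \in T0, ~~ [&& a == y, pref I y x b & b \in s]
        & ~~ [&& b == y, pref I y x a & a \in s]].
  apply/setP=> -[a b]; rewrite loop // !inE /cut /= !mem_enum !andbT.
  by rewrite negb_or.
elim: s T0 => [|z s IHs] T0 sym0 a b /=; first by rewrite !andbF andbT.
have eqT1 : body T0 z = T0 :\: [set p | pref I y x z && ((p == (y, z)) || (p == (z, y)))].
  apply/setP=> p; rewrite /body !valueE !inE /=.
  case: ifP; first by case/andP=> _ ->; rewrite !inE /= negb_or -andbA andbCA.
  case: (pref I y x z) => //=; rewrite andbT => yzF.
  case: eqP => [->|_] /=; first by rewrite yzF.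
  by case: eqP => // ->; apply/negP => /sym0; rewrite yzF.
rewrite IHs eqT1.
  rewrite !inE !xpair_eqE.
  case: (a =P y) => [->|_]; case: (b =P y) => [->|_] //=;
  rewrite ?andbT ?andbF ?orbF //=.
  - case: (y =P z) => [<-|_] //=; rewrite ?andbF //= ?andbT.
    by case: (pref I y x y); case: (_ \in s) => //=; rewrite ?andbF.
  - by case: (b =P z) => [->|_] /=; rewrite ?andbF //= ?andbT;
      case: (pref I y x _); case: (_ \in s); case: (_ \in T0) => //=.
  - by case: (a =P z) => [->|_] /=; rewrite ?andbF //= ?andbT;
      case: (pref I y x _); case: (_ \in s); case: (_ \in T0) => //=.
move=> u v; rewrite !inE !xpair_eqE => /andP[nuv /sym0->]; rewrite andbT.
by apply: contra nuv => /andP[->] /orP[] /andP[-> ->]; rewrite ?orbT.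
Qed.

Lemma subtable_cut T (P : pred (V * V)) :
  subtable I T -> (forall u v, P (u, v) = P (v, u)) -> subtable I [set p in T | P p].
Proof.
case=> adjT symT symP; split=> u v; rewrite !inE => /andP[uvT uvP].
  exact: adjT.
by rewrite symT // symP.
Qed.

Lemma cutC y x u v : cut y x (u, v) = cut y x (v, u).
Proof. by rewrite /cut /= orbC. Qed.

Lemma value_rounds body T :
  value (rounds body T) = iter (#|V| * #|V|) (fun T => value (body T)) T.
Proof.
rewrite /rounds value_for_each; set f := fun T => value (body T).
have fE T0 : value (for_each (enum V) (fun=> body) T0) = iter #|V| f T0.
  by rewrite value_for_each foldl_const -cardE.
suff loop s T0 : foldl (fun T (_ : V) => value (for_each (enum V) (fun=> body) T)) T0 s
    = iter (size s * #|V|) f T0 by rewrite loop -cardE.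
elim: s T0 => //= x s IHs T0; rewrite fE.
by rewrite IHs mulSn addnC iterD.
Qed.

Lemma row_neq_nil T x : value (row I T x) != [::] -> subtable I T ->
  (x, first_of I T x) \in T.
Proof.
move=> nex [adjT _]; case: (row_spec adjT x) => <- _; rewrite /first_of.
by case: (value _) nex => //= *; rewrite mem_head.
Qed.

(** The reason why the pair of [y] and [w] may have left the table: [y] is the first choice of some
    [x] that it likes better. *)
Definition proposed T (y w : V) :=
  exists x, [/\ (x, y) \in T, first_of I T x = y & pref I y x w].

Definition propose_inv T :=
  subtable I T /\
  forall u v, adj I u v -> (u, v) \notin T -> proposed T u v \/ proposed T v u.

(** A first entry that survives remains first, so only proposals cut by this step need a substitute,
    and [x] provides it. *)
Lemma propose_cut x T : propose_inv T -> value (row I T x) != [::] ->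
  propose_inv [set p in T | ~~ cut (first_of I T x) x p].
Proof.
set y0 := first_of I T x => -[subT propT] nex.
have [adjT symT] := subT.
have xyT : (x, y0) \in T by apply: row_neq_nil.
set T' := [set p in T | _].
have subT' : subtable I T' by apply: subtable_cut => // u v; rewrite cutC.
have [adjT' symT'] := subT'.
have firstT' u v : (u, v) \in T' -> first_of I T u = v -> first_of I T' u = v.
  move=> uv fuv; apply: (first_of_uniq adjT') => // w; rewrite inE -fuv.
  by case/andP=> /(first_ofP adjT)[].
have y0x := adjT _ _ (symT _ _ xyT).
have xyT' : (x, y0) \in T'.
  rewrite inE xyT /cut /= eqxx (pref_irr y0x) //=.
  by case: eqP => // xy; move/adjT: xyT; rewrite xy adj_irr.
have new w : adj I y0 w -> pref I y0 x w -> proposed T' y0 w.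
  by move=> _ xw; exists x; split=> //; apply: firstT'.
have keep y w : adj I y w -> proposed T y w -> proposed T' y w.
  move=> yw [x' [x'y fx' pw]].
  have [x'yT'|] := boolP ((x', y) \in T').
    by exists x'; split=> //; apply: firstT'.
  (* If the proposal of [x'] to [y] was cut, either [x'] is [y0], impossible since [y] heads its
     list, or [y] is [y0], which prefers [x] to [x'] and hence to [w]. *)
  rewrite inE x'y /= negbK => /orP[] /andP[/eqP /= eq0 px].
    subst x'; case: (first_ofP adjT (symT _ _ xyT)) => _; rewrite fx'.
    case=> [xy|yx]; first by rewrite xy (pref_irr (adjT _ _ x'y)) in px.
    by case: (pref_asym _ _ px yx); apply: adjT => //; apply: symT.
  rewrite eq0 in yw pw x'y *; apply: new => //.
  by apply: (pref_trans _ _ _ px pw) => //; apply/adjT/symT.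
split=> // u v uv; rewrite inE; have [uvT /negPn|/(propT _ _ uv) [|] + _] := boolP ((u, v) \in T).
- case/orP=> /andP[/eqP /= eq0 px]; [left|right];
    by rewrite eq0 in uv *; apply: new; rewrite // adj_sym.
- by move=> p; left; apply: keep.
- by move=> p; right; apply: keep; rewrite ?(adj_sym I v).
Qed.
Lemma mem_full_table u v : ((u, v) \in value (full_table I)) = adj I u v.
Proof.
rewrite /full_table value_for_each.
have inner x s T : ((u, v) \in foldl (fun T y => value (let! uv := tick (adj I x y) in
    if uv then tick ((x, y) |: T) else ret T)) T s)
    = ((u, v) \in T) || [&& x == u, v \in s & adj I u v].
  elim: s T => [|y s IHs] T /=; first by rewrite andbF orbF.
  rewrite IHs !valueE /= inE.
  have [->|nxu] := eqVneq x u; last first.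
    by case: ifP => _; rewrite /= !orbF ?inE ?xpair_eqE ?(eq_sym u) ?(negbTE nxu).
  have [->|nvy] := eqVneq v y; last first.
    by case: ifP => _; rewrite ?inE ?xpair_eqE ?(negbTE nvy) ?andbF.
  by case: ifP => uy; rewrite /= ?inE ?eqxx ?uy ?andbF ?orbT.
suff outer s T : ((u, v) \in foldl (fun T x => value (for_each (enum V) (fun y T =>
    let! uv := tick (adj I x y) in if uv then tick ((x, y) |: T) else ret T) T)) T s)
    = ((u, v) \in T) || (u \in s) && adj I u v by rewrite outer inE mem_enum.
elim: s T => [|x s IHs] T /=; first by rewrite orbF.
rewrite IHs value_for_each inner mem_enum !inE /= (eq_sym u).
by case: (x == u); case: (adj I u v); case: (u \in s); rewrite ?orbF ?orbT.
Qed.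

(** The last entry stands for the whole list. In a subtable, membership excludes an empty list, for
    which [last_of] is merely [y]. *)
Definition covered T (y w : V) :=
  (y, last_of I T y) \in T /\ pref I y (last_of I T y) w.

(** The cancellation covers all vertices, those with an empty list being fixed by both maps; it
    makes [first_of] a permutation with inverse [last_of]. *)
Definition rotation_inv T :=
  [/\ subtable I T, cancel (first_of I T) (last_of I T)
    & forall u v, adj I u v -> (u, v) \notin T -> covered T u v \/ covered T v u].

(** After the rounds every single proposal is idle. If [y] is the first choice of [x], this means
    that [y] lists nobody after [x]; so the proposer is the last entry and [proposed] becomes
    [covered]. *)
Lemma propose_phase :
  rotation_inv (value (let! T := full_table I in rounds (propose I) T)).
Proof.
rewrite value_bind value_rounds.
pose body x (T : {set V * V}) :=
  let! s := row I T x in if s is y :: _ then truncate I y x T else ret T.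
have proposeE T : value (propose I T) = foldl (fun T x => value (body x T)) T (enum V).
  by rewrite /propose value_for_each.
have bodyE x T : subtable I T -> value (body x T) =
    if value (row I T x) == [::] then T
    else [set p in T | ~~ cut (first_of I T x) x p].
  move=> subT; rewrite /body value_bind /first_of.
  by case: (value (row I T x)) => //= y s; rewrite value_truncate.
have body_inv T x : propose_inv T ->
    propose_inv (value (body x T)) /\ value (body x T) \subset T.
  move=> invT; have [subT _] := invT; rewrite bodyE //.
  case: eqP => [//|/eqP nex]; split; first exact: propose_cut.
  by apply/subsetP => p; rewrite inE => /andP[].
have [|||] := @iter_fixed _ propose_inv (fun T => value (propose I T))
  (#|V| * #|V|) (value (full_table I)).
- move=> T invT; rewrite proposeE.
  by case: (foldl_fixed (enum V) body_inv invT).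
- split; first by split=> u v; rewrite !mem_full_table // adj_sym.
  by move=> u v uv; rewrite mem_full_table uv.
- by rewrite -card_prod max_card.
set T := iter _ _ _ => invT; rewrite proposeE => fixT.
have [_ /(_ fixT) fixed] := foldl_fixed (enum V) body_inv invT.
have [[adjT symT] propT] := invT; have subT := conj adjT symT.
have FL : cancel (first_of I T) (last_of I T).
  move=> x; have := fixed x (mem_enum _ _); rewrite bodyE //.
  case: eqP => [nil _|/eqP nex fx].
    by rewrite /last_of /first_of nil /= nil.
  have xfT := row_neq_nil nex subT.
  apply: (last_of_uniq adjT) => [|w]; first exact: symT.
  move=> wT; move/setP/(_ (first_of I T x, w)): fx.
  rewrite inE wT /cut /= eqxx /= negb_or => /andP[nx _].
  have [->|wx] := eqVneq w x; first by left.
  right; have := pref_total (adjT _ _ wT) (adjT _ _ (symT _ _ xfT)) wx.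
  by rewrite (negbTE nx) orbF.
split=> // u v uv uvT.
have prop_cov y w : proposed T y w -> covered T y w.
  by case=> x [xy fx pw]; rewrite /covered -fx FL fx; split=> //; apply: symT.
by case: (propT u v uv uvT) => /prop_cov; auto.
Qed.
End Tan.

(** * Rotations *)

Section Rotation.
Variables (V : finType) (I : roommates V) (T : {set V * V}).
Hypothesis invT : rotation_inv I T.

Let F := first_of I T.
Let L := last_of I T.
Let S := second_of I T.
Let nxt x := value (Defs.next I T x).

Let adjT u v : (u, v) \in T -> adj I u v.
Proof. by case: invT => -[/(_ u v)]. Qed.
Let symT u v : (u, v) \in T -> (v, u) \in T.
Proof. by case: invT => -[_ /(_ u v)]. Qed.
Let FK : cancel F L.
Proof. by case: invT. Qed.
Let LK : cancel L F.
Proof. exact: canF_sym. Qed.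

Lemma first_min u v : (u, v) \in T -> ~ pref I u v (F u).
Proof.
move=> uv vF; case: (first_ofP adjT uv) => uF [vE|Fv].
  by move: vF; rewrite vE -/F (pref_irr (adjT uF)).
exact: pref_asym (adjT uv) (adjT uF) vF Fv.
Qed.

Lemma last_max u v : (u, v) \in T -> ~ pref I u (L u) v.
Proof.
move=> uv Lv; case: (last_ofP adjT uv) => uL [vE|vL].
  by move: Lv; rewrite vE -/L (pref_irr (adjT uL)).
exact: pref_asym (adjT uv) (adjT uL) vL Lv.
Qed.

Lemma second_min u v : (u, v) \in T -> v != F u -> ~ pref I u v (S u).
Proof.
move=> uv vF vS; case: (second_ofP adjT uv vF) => uS _ [vE|Sv].
  by move: vS; rewrite vE -/S (pref_irr (adjT uS)).
exact: pref_asym (adjT uv) (adjT uS) vS Sv.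
Qed.

Definition has_second x := ((x, S x) \in T) && (S x != F x).

Lemma has_secondP x v : (x, v) \in T -> v != F x -> has_second x.
Proof. by move=> xv vF; case: (second_ofP adjT xv vF) => xS SF _; apply/andP. Qed.

Lemma nextE x : has_second x -> nxt x = L (S x).
Proof.
case/andP=> /symT xS _; rewrite /nxt /Defs.next !value_bind /= -/(S x) /L /last_of.
by case: (row_spec adjT (S x)) => /(_ x); rewrite xS; case: (value _).
Qed.

Lemma first_next x : has_second x -> F (nxt x) = S x.
Proof. by move/nextE->; rewrite LK. Qed.

Lemma next_neq x : has_second x -> nxt x != x.
Proof.
move=> hx; case/andP: (hx) => _; apply: contraNneq => xE.
by rewrite -(first_next hx) xE.
Qed.

(** If [x] were the last entry of [S x], then [nxt x = x]. Hence truncating the list of [S x] after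
    [x] does remove [nxt x]. *)
Lemma pref_next x : has_second x ->
  (S x, nxt x) \in T /\ pref I (S x) x (nxt x).
Proof.
move=> hx; case/andP: (hx) => /symT xS _; rewrite nextE //.
case: (last_ofP adjT xS) => SL [xE|//].
by have := next_neq hx; rewrite nextE // /L -xE eqxx.
Qed.

(** Otherwise [S x] would be both first and last for [nxt x], so [nxt x] would head the list of
    [S x], which strictly prefers [x]. *)
Lemma has_second_next x : has_second x -> has_second (nxt x).
Proof.
move=> hx; have [SzT px] := pref_next hx; have zE := nextE hx.
have FzE := first_next hx; have zT := symT SzT.
apply: (@has_secondP _ (L (nxt x))); first by case: (last_ofP adjT zT).
apply/eqP => LF; have := LK (nxt x); rewrite LF FzE => FS.
have xS : (S x, x) \in T by case/andP: hx => /symT.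
by apply: (first_min xS); rewrite FS.
Qed.

(** * A rotation and its elimination *)

Variables (r : V) (m : nat).
Hypotheses (m_gt0 : 0 < m) (iter_m : iter m nxt r = r) (hr : has_second r).
Let xs := traject nxt r m.

Lemma iter_has_second i x : has_second x -> has_second (iter i nxt x).
Proof. by move=> hx; elim: i => //= i; apply: has_second_next. Qed.

Lemma mem_rotation x : reflect (exists i, x = iter i nxt r) (x \in xs).
Proof. exact: cyclic_trajectP. Qed.

Lemma rotation_has_second x : x \in xs -> has_second x.
Proof. by case/mem_rotation=> i ->; apply: iter_has_second. Qed.

Lemma rotation_start : r \in xs.
Proof. by apply/mem_rotation; exists 0. Qed.

Lemma rotation_next x : x \in xs -> nxt x \in xs.
Proof. by case/mem_rotation=> i ->; apply/mem_rotation; exists i.+1. Qed.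

Lemma rotation_iter x : x \in xs -> iter m nxt x = x.
Proof. by case/mem_rotation=> i ->; rewrite -iterD addnC iterD iter_m. Qed.

Lemma rotation_prev z : z \in xs -> exists2 x, x \in xs & z = nxt x.
Proof.
move=> zxs; exists (iter m.-1 nxt z); last by rewrite -iterS prednK // rotation_iter.
by case/mem_rotation: zxs => i ->; rewrite -iterD; apply/mem_rotation; exists (m.-1 + i).
Qed.

Lemma next_inj : {in xs &, injective nxt}.
Proof.
move=> x y xxs yxs eqn; rewrite -(rotation_iter xxs) -(rotation_iter yxs).
by rewrite -(prednK m_gt0) !iterSr eqn.
Qed.

Lemma second_inj : {in xs &, injective S}.
Proof.
move=> x y xxs yxs eqS; apply: next_inj => //.
by rewrite !nextE ?rotation_has_second // eqS.
Qed.

(* Eliminating the rotation would remove the pair of [z] and its second entry. *)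
Definition bad z := [&& z \in xs, F z \in xs & S (F z) == z].

(** [z] is the second entry of [F z] by assumption and the last one by [FK], so the list ends
    there. *)
Lemma bad_row z w : bad z -> (F z, w) \in T -> w = F (F z) \/ w = z.
Proof.
case/and3P=> zxs Fzxs /eqP SF FzT; have [|nw] := eqVneq w (F (F z)); first by left.
right; case: (second_ofP adjT FzT nw) => SzT _ []; rewrite -/S SF // => zw.
by case: (last_max FzT); rewrite FK.
Qed.

(** [x] is on the list of [S x = F (nxt x)], which has no entries besides its first one and [nxt x];
    as [x] is not [nxt x], it is the first. *)
Lemma bad_first x : x \in xs -> bad (nxt x) -> F (F (nxt x)) = x /\ bad (F (nxt x)).
Proof.
move=> xxs bx; have hx := rotation_has_second xxs.
have FzE := first_next hx; have nx := next_neq hx.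
have xS : (F (nxt x), x) \in T by rewrite FzE; case/andP: hx => /symT.
have xE : F (F (nxt x)) = x.
  by case: (bad_row bx xS) => [//|xE]; rewrite -xE eqxx in nx.
split=> //; case/and3P: bx => _ Fx _; rewrite /bad Fx xE xxs -FzE eqxx.
by [].
Qed.

(** Badness spreads backwards: [F (nxt x)] is bad and on the cycle, hence some [nxt y], and a second
    use of [bad_first] makes [F (F (nxt x)) = x] bad. *)
Lemma bad_all z : bad z -> {in xs, forall x, bad x}.
Proof.
have back x : x \in xs -> bad (nxt x) -> bad x.
  move=> xxs bz; have [xE bFz] := bad_first xxs bz.
  have Fzxs : F (nxt x) \in xs by case/and3P: bFz.
  case: (rotation_prev Fzxs) => y yxs FzE; rewrite FzE in bFz.
  by have [_] := bad_first yxs bFz; rewrite -FzE xE.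
have down i j : bad (iter (i + j) nxt r) -> bad (iter j nxt r).
  elim: i => // i IHi; rewrite addSn iterS => /back bi; apply/IHi/bi.
  by apply/mem_rotation; exists (i + j).
move=> bz x; have /mem_rotation[i zE] : z \in xs by case/and3P: bz.
have br : bad r by apply: (down i 0); rewrite addn0 -zE.
case/trajectP=> j ltjm ->; apply: (down (m - j)).
by rewrite subnK ?iter_m // ltnW.
Qed.

(* All lists met by a bad rotation have length two, so that no walk enters it
   from outside. *)
Lemma bad_start u k z : has_second u -> iter k nxt u = r -> bad z ->
  size (value (row I T u)) <= 2.
Proof.
move=> hu uk /bad_all all_bad.
(* If [nxt x = nxt y] with [y] on the cycle, then [x] is on the two-entry list of [F (nxt y)], so it
   is [y] or [nxt y]. *)
have back x : has_second x -> nxt x \in xs -> x \in xs.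
  move=> hx nxs; have [y yxs zE] := rotation_prev nxs.
  have bz := all_bad _ nxs; rewrite zE in bz.
  have xS : (F (nxt y), x) \in T.
    by rewrite -zE first_next //; case/andP: hx => /symT.
  case: (bad_row bz xS) => ->; last by rewrite -zE.
  by case: (bad_first yxs bz) => ->.
have uxs : u \in xs.
  have : iter k nxt u \in xs by rewrite uk rotation_start.
  elim: k {uk} => // k IHk /back xk; apply/IHk/xk.
  exact: iter_has_second.
have bz := all_bad _ (rotation_next uxs).
have [uE bFz] := bad_first uxs bz.
rewrite leqNgt; apply/negP => /(row_size_gt2 adjT) [v [uv vF vS]].
rewrite -/F -/S in vF vS; case/andP: (hu) => uS SF.
(* [u] is [F] of the bad vertex [F (nxt u)], so [bad_row] leaves it two entries. *)
have u2 w : (u, w) \in T -> w = F u \/ w = F (nxt u).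
  by rewrite -{1}uE => /(bad_row bFz); rewrite uE.
case: (u2 _ uv) vF vS => ->; first by rewrite eqxx.
by case: (u2 _ uS) SF => ->; rewrite eqxx.
Qed.

Hypothesis not_bad : forall z, ~ bad z.

Let cut_any p := [exists x in xs, cut I (S x) x p].
Let T' := [set p in T | ~~ cut_any p].

(** If [y] caused the cut of [(x, S x)], either [S y = x] and [x] prefers [y] to [S x], so [y] is
    [F x] and [x] is bad; or [S y = S x], so [y] is [x]. *)
Lemma rotation_second_kept x : x \in xs -> (x, S x) \in T'.
Proof.
move=> xxs; have hx := rotation_has_second xxs; case/andP: (hx) => xS SF.
rewrite inE xS; apply/existsP => -[y /andP[yxs /orP[]]] /= /andP[/eqP eqS px].
  have hy := rotation_has_second yxs; case/andP: (hy) => yS SyF.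
  have yT : (x, y) \in T by rewrite eqS; apply: symT.
  have yF : y = F x.
    apply/eqP/negPn/negP => nyF; apply: (second_min yT nyF).
    by rewrite {1}eqS.
  by apply: (@not_bad x); rewrite /bad xxs -yF yxs -eqS eqxx.
rewrite -eqS in px; move/(second_inj xxs yxs): eqS px => <-.
by rewrite (pref_irr (adjT (symT xS))).
Qed.

Lemma removedP u v : (u, v) \in T -> (u, v) \notin T' ->
  exists2 x, x \in xs & (u = S x /\ pref I u x v) \/ (v = S x /\ pref I v x u).
Proof.
move=> uv; rewrite inE uv /= negbK => /existsP[x /andP[xxs]].
by case/orP=> /= /andP[/eqP uE px]; exists x => //; [left|right]; rewrite uE.
Qed.

Lemma subT' p : p \in T' -> p \in T.
Proof. by rewrite inE => /andP[]. Qed.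

(** Truncating the list of [u] cannot reach its best entry. Truncating that of [F u] means
    [F u = S x] with [x] on the rotation, and then [u = nxt x] is on it too. *)
Lemma first_kept u : u \notin xs -> (u, F u) \in T -> (u, F u) \in T'.
Proof.
move=> uxs uF; apply/negPn/negP => /(removedP uF)[x xxs].
have hx := rotation_has_second xxs; case/andP: (hx) => xS SF.
case=> [[uE px]|[FE px]].
  by apply: (first_min _ px); rewrite uE; apply: symT.
by have := rotation_next xxs; rewrite nextE // -FE FK (negbTE uxs).
Qed.

Lemma rotation_subtable : subtable I T'.
Proof.
apply: subtable_cut; first by case: invT.
by move=> u v; congr negb; apply: eq_existsb => x; rewrite cutC.
Qed.

Lemma row_kept u v : (u, v) \in T -> exists w, (u, w) \in T'.
Proof.
move=> uv; have [uxs|uxs] := boolP (u \in xs).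
  by exists (S u); apply: rotation_second_kept.
by exists (F u); apply: first_kept => //; case: (first_ofP adjT uv).
Qed.

(** On the rotation, [u = nxt x] loses its first entry [S x]; [S u] becomes first, and its list now
    ends with [u]. Off the rotation, [F u] stays first for [u], and [u] last for [F u], unless the
    list of [u] is empty. *)
Lemma rotation_inv_cut : rotation_inv I T'.
Proof.
have sT := rotation_subtable; have [adjT' symT'] := sT.
have lastS u : u \in xs -> last_of I T' (S u) = u.
  move=> uxs; have uS := symT' _ _ (rotation_second_kept uxs).
  apply: (last_of_uniq adjT') => // w wT.
  have [->|wu] := eqVneq w u; [by left|right].
  have := pref_total (adjT' _ _ wT) (adjT' _ _ uS) wu.
  case/orP=> // uw; move: wT; rewrite inE => /andP[_ /existsP[]]; exists u.
  by rewrite uxs /cut /= eqxx uw.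
split=> //.
  move=> u; have [uxs|uxs] := boolP (u \in xs).
    have [x xxs uE] := rotation_prev uxs.
    have hx := rotation_has_second xxs; have hu := rotation_has_second uxs.
    have uS := rotation_second_kept uxs.
    have -> : first_of I T' u = S u.
      apply: (first_of_uniq adjT' uS) => w uw.
      have [wF|nwF] := eqVneq w (F u); last first.
        by case: (second_ofP adjT (subT' uw) nwF).
      move: uw; rewrite wF inE => /andP[_ /existsP[]]; exists x.
      rewrite xxs /cut /= uE first_next // eqxx; case: (pref_next hx) => _ ->.
      by rewrite orbT.
    exact: lastS.
  have [/eqP nil|ex] := boolP (value (row I T' u) == [::]).
    by rewrite /last_of /first_of nil /= nil.
  have uF' := row_neq_nil ex sT.
  have uF : (u, F u) \in T by case: (first_ofP adjT (subT' uF')).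
  have uFT' := first_kept uxs uF.
  have -> : first_of I T' u = F u.
    by apply: first_of_uniq => // w /subT' /(first_ofP adjT)[].
  apply: last_of_uniq; [by [] | exact: symT' |].
  by move=> w /subT' /(last_ofP adjT)[_]; rewrite -/L FK.
have covS x w : x \in xs -> pref I (S x) x w -> covered I T' (S x) w.
  by move=> xxs xw; rewrite /covered lastS //; split=> //; apply/symT'/rotation_second_kept.
(* Lists only shrink and none is emptied, so the new last entry is at least as good as the old
   one. *)
have covT u w : adj I u w -> covered I T u w -> covered I T' u w.
  move=> uw [/row_kept[x ux] Lw]; have [uL' _] := last_ofP adjT' ux.
  split=> //; have [uL] := last_ofP adjT (subT' uL'); case=> [-> //|L'L].
  exact: pref_trans (adjT uL) (adjT' _ _ uL') uw L'L Lw.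
move=> u v uv uvT'.
have [uvT|uvT] := boolP ((u, v) \in T).
  have [x xxs [[uE px]|[vE px]]] := removedP uvT uvT'; [left|right].
    by rewrite uE in px *; apply: covS.
  by rewrite vE in px *; apply: covS.
case: invT => _ _ /(_ u v uv uvT) [] /covT; [left|right]; auto.
by rewrite adj_sym in uv; auto.
Qed.

Lemma rotation_cut_neq : T' != T.
Proof.
apply/eqP => /setP /(_ (S r, nxt r)); have [Sr pr] := pref_next hr.
rewrite inE Sr /=; apply/negP; rewrite negbK; apply/existsP; exists r.
by rewrite rotation_start /cut /= eqxx pr.
Qed.

End Rotation.

(** * Correctness of Tan's algorithm *)

Section TanCorrect.
Variables (V : finType) (I : roommates V).
Implicit Types T : {set V * V}.

Lemma find_longP T :
  if value (find_long I T) is Some u then (2 < size (value (row I T u)) : Prop)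
  else forall u, size (value (row I T u)) <= 2.
Proof.
rewrite /find_long value_for_each.
suff loop s o : (if o is Some u then (2 < size (value (row I T u)) : Prop) else True) ->
    if foldl (fun o u => value (let! s := row I T u in
        let! n := ticks (size s) (size s) in if 2 < n then tick (Some u) else ret o)) o s
      is Some u then (2 < size (value (row I T u)) : Prop)
    else o = None /\ {in s, forall u, size (value (row I T u)) <= 2}.
  have := loop (enum V) None Logic.I; case: foldl => // -[_ le2] u.
  by apply: le2; rewrite mem_enum.
elim: s o => [|u s IHs] o /=; first by case: o.
rewrite !value_bind value_if => oP; case: ltnP => [gt2|le2].
  by have := IHs (Some u) gt2; case: foldl => // -[].
by have := IHs o oP; case: foldl => // -[-> le2s]; split=> // v /predU1P[->|/le2s].
Qed.

(** By the pigeonhole principle the iterate of index [#|V|] has occurred before, so it is periodic.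
    This is why [eliminate] takes [#|V|] steps before listing a cycle. *)
Lemma iter_card_periodic (g : V -> V) u :
  exists2 k, 0 < k & iter k g (iter #|V| g u) = iter #|V| g u.
Proof.
have /trajectP[i lti eqi] : looping g u #|V|.
  rewrite -[looping _ _ _]negbK -looping_uniq; apply/negP => /card_uniqP.
  rewrite size_traject => eqc.
  by have := max_card (mem (traject g u #|V|.+1)); rewrite eqc ltnn.
exists (#|V| - i); first by rewrite subn_gt0.
by rewrite [in LHS]eqi -iterD subnK // ltnW.
Qed.

Lemma value_truncates ps T : subtable I T ->
  value (for_each ps (fun p => truncate I p.2 p.1) T)
  = [set p in T | ~~ has (fun q => cut I q.2 q.1 p) ps].
Proof.
rewrite value_for_each; elim: ps T => [|q ps IHps] T subT /=.
  by apply/setP=> p; rewrite inE andbT.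
rewrite value_truncate // IHps; last first.
  by apply: subtable_cut => // u v; rewrite cutC.
by apply/setP=> p; rewrite !inE negb_or andbA.
Qed.

Lemma value_second_entries T s :
  value (for_each s (fun x ps =>
    let! y := second_entry I T x in tick ((x, y) :: ps)) [::])
  = rev [seq (x, second_of I T x) | x <- s].
Proof.
rewrite value_for_each /rev; elim: s [::] => //= x s IHs ps.
by rewrite IHs !value_bind.
Qed.

(** The rotation is reached from a list of length at least 3, so [bad_start] rules out bad vertices.
    Its elimination always deletes a pair, so an unchanged table means that no long list was
    found. *)
Lemma eliminate_inv T : rotation_inv I T ->
  [/\ rotation_inv I (value (eliminate I T)), value (eliminate I T) \subset T
    & value (eliminate I T) = T -> forall u, size (value (row I T u)) <= 2].
Proof.
move=> invT; rewrite /eliminate value_bind.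
case: (value (find_long I T)) (find_longP T) => [u|]; last by [].
move=> gt2; rewrite value_bind value_for_each foldl_const -cardE.
set nxt := fun x => value (Defs.next I T x); set r := iter _ _ _.
have [[adjT symT] _ _] := invT.
have hu : has_second I T u.
  by have [v [uv vF _]] := row_size_gt2 adjT gt2; apply: (has_secondP invT uv).
have hr : has_second I T r by apply: (iter_has_second invT).
have [m [m_gt0 iter_m _ xsE]] := value_cycle_from (iter_card_periodic nxt u).
rewrite value_bind xsE value_bind value_truncates //; set T1 := [set p in T | _].
have -> : T1 = [set p in T | ~~ [exists x in traject nxt r m, cut I (second_of I T x) x p]].
  apply/setP=> p; rewrite !inE; congr (_ && ~~ _).
  rewrite value_second_entries has_rev has_map.
  by apply/hasP/existsP => [[x xxs px]|[x /andP[xxs px]]]; exists x; rewrite // xxs.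
have not_bad z : ~ bad I T r m z.
  by move=> /(bad_start invT m_gt0 iter_m hr hu (erefl r)); rewrite leqNgt gt2.
have := rotation_inv_cut invT m_gt0 iter_m hr not_bad.
have := rotation_cut_neq invT m_gt0 iter_m hr.
set T2 := [set p in T | _] => neq inv2; split=> //.
  by apply/subsetP => p; rewrite inE => /andP[].
by move=> eqT; rewrite eqT eqxx in neq.
Qed.

Lemma value_first_entries T : value (first_entries I T) =1 first_of I T.
Proof.
move=> v; rewrite /first_entries value_bind value_for_each.
set body := fun (f : {ffun V -> V}) u => value _.
suff loop s (f : {ffun V -> V}) :
    foldl body f s v = if v \in s then first_of I T v else f v.
  by rewrite loop mem_enum.
elim: s f => //= u s IHs f; rewrite IHs inE /body value_bind /= ffunE /first_of.
by have [->|] := eqVneq v u; rewrite //= if_same.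
Qed.

(** The rounds are at least as many as the pairs, so the final table is fixed by [eliminate] and its
    lists have at most two entries: the images of [u] under the permutation and its inverse. *)
Lemma tan_stable_partition : stable_partition I (value (tan I)).
Proof.
have inv0 := propose_phase I.
rewrite /tan 4!value_bind value_rounds.
have shrink T : rotation_inv I T ->
    rotation_inv I (value (eliminate I T)) /\ value (eliminate I T) \subset T.
  by case/eliminate_inv.
rewrite value_bind in inv0.
have := iter_fixed shrink inv0; set T0 := value _ => /(_ (#|V| * #|V|)) [].
  by rewrite -card_prod max_card.
set T := iter _ _ _ => invT eqT; have [_ _ /(_ eqT) le2] := eliminate_inv invT.
set f := value (first_entries I T).
have [subT FK cov] := invT; have [adjT symT] := subT.
(* Injectivity keeps [insubd] from falling back on the identity. *)
have f_inj : injectiveb f.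
  by apply/injectiveP => u v; rewrite !value_first_entries; apply: can_inj FK _ _.
pose pi : {perm V} := insubd (1%g : {perm V}) f; rewrite -[value _]/pi.
have valpi : val pi = f by apply: insubdK.
have piE u : pi u = first_of I T u.
  by rewrite -value_first_entries -/f -valpi -pvalE.
have piVE u : (pi^-1)%g u = last_of I T u.
  by apply: (perm_inj (s := pi)); rewrite permKV piE (canF_sym FK).
have firstT u : first_of I T u != u -> (u, first_of I T u) \in T.
  move=> Fu; apply: row_neq_nil => //; apply: contra Fu => /eqP nil.
  by rewrite /first_of nil.
split=> [u|u v uv]; rewrite !piE !piVE.
  move=> /firstT uF; have [uL Llast] := last_ofP adjT uF; split; try exact: adjT.
  by case: Llast => [->|]; rewrite ?eqxx.
move=> vF block.
(* An entry of [u] other than the first is the last, and it is not preferred to itself. *)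
have uvT : (u, v) \notin T.
  apply/negP => uvT; have [uF _] := first_ofP adjT uvT.
  have Fu : first_of I T u == u = false by apply/eqP => Fu; have := adjT _ _ uF; rewrite Fu adj_irr.
  move: block; rewrite Fu /=.
  case: (row_size_le2 adjT (le2 u) uvT) vF => ->; first by rewrite eqxx.
  by move=> _; rewrite (pref_irr (adjT _ _ (last_ofP adjT uvT).1)).
(* If [u] is covered, its list is not empty and its last entry beats [v], against [block]; [v] being
   covered is the conclusion sought. *)
case: (cov u v uv uvT) => -[wL Lw].
  have [uF _] := first_ofP adjT wL.
  have Fu : first_of I T u == u = false by apply/eqP => Fu; have := adjT _ _ uF; rewrite Fu adj_irr.
  by move: block; rewrite Fu /= => /(pref_asym uv (adjT _ _ wL)) [].
split=> //; have [vFT _] := first_ofP adjT wL.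
by apply/eqP => Fv; have := adjT _ _ vFT; rewrite Fv adj_irr.
Qed.
End TanCorrect.

(** * Lower bound on removable sets *)

Lemma even_card_involution (V : finType) (A : {set V}) (t : V -> V) :
  {in A, forall x, [/\ t x \in A, t x != x & t (t x) = x]} -> ~~ odd #|A|.
Proof.
have [n] := ubnP #|A|; elim: n A => // n IHn A; rewrite ltnS => leA tA.
have [->|[x xA]] := set_0Vmem A; first by rewrite cards0.
have [txA tx ttx] := tA x xA.
rewrite (cardsD1 x) xA (cardsD1 (t x) (A :\ x)) !inE tx txA /= negbK.
apply: IHn => [|y].
  by move: leA; rewrite (cardsD1 x) xA (cardsD1 (t x) (A :\ x)) !inE tx txA /=; lia.
rewrite !inE => /and3P[ytx yx yA]; have [tyA ty tty] := tA y yA.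
rewrite tyA ty tty andbT; split=> //; apply/andP; split.
  by apply: contraNneq yx => ty_tx; rewrite -tty ty_tx ttx.
by apply: contraNneq ytx => ty_x; rewrite -tty ty_x.
Qed.

(** * Matchings as partner maps *)

Section Partner.
Variables (V : finType) (I : roommates V).
Implicit Types M : {set {set V}}.

Lemma edge_adj u v : ([set u; v] \in edges I) = adj I u v.
Proof.
rewrite inE; apply/existsP/idP => [[a /existsP[b /andP[ab /eqP eqe]]]|uv]; last first.
  by exists u; apply/existsP; exists v; rewrite uv eqxx.
have nab : a != b by apply: contraTneq ab => ->; rewrite adj_irr.
have : a \in [set u; v] by rewrite eqe set21.
have : b \in [set u; v] by rewrite eqe set22.
case/set2P=> eb /set2P[] ea; subst a b; rewrite ?eqxx // in nab *.
by rewrite adj_sym.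
Qed.

Lemma matching_uniq M u v w :
  matching I M -> [set u; v] \in M -> [set u; w] \in M -> v = w.
Proof.
case/andP=> /subsetP sME trivM uv uw.
have eqe : [set u; v] = [set u; w].
  apply: contraTeq (set21 u v) => /(trivIsetP trivM _ _ uv uw) /disjointFr.
  by move=> dis; apply/negP => /dis; rewrite set21.
have nvu : v != u.
  by move/sME: uv; rewrite edge_adj; apply: contraTneq => ->; rewrite adj_irr.
by have := set22 u v; rewrite eqe => /set2P[vu|//]; rewrite vu eqxx in nvu.
Qed.

(* [mu u == u] encodes that [u] is unmatched. *)
Definition stable_partner (mu : V -> V) (S : {set V}) :=
  [/\ involutive mu, forall u, mu u != u -> u \notin S,
    forall u, mu u != u -> adj I u (mu u)
  & forall u v, u \notin S -> v \notin S -> adj I u v -> mu u != v ->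
      ~~ (((mu u == u) || pref I u v (mu u)) && ((mu v == v) || pref I v u (mu v)))].

Lemma stable_matching_partner M : stable_matching I M ->
  exists mu, stable_partner mu set0.
Proof.
case=> matM stM; have [/subsetP sME trivM] := andP matM.
pose mu u := odflt u [pick w | [set u; w] \in M].
have muE u w : [set u; w] \in M -> mu u = w.
  move=> uw; rewrite /mu; case: pickP => [x ux|/(_ w)]; last by rewrite uw.
  exact: matching_uniq ux uw.
have muM u : mu u != u -> [set u; mu u] \in M.
  by rewrite /mu; case: pickP => //= _; rewrite eqxx.
exists mu; split=> [u|u|u|u v _ _ uv nuv].
- have [mE|/muM uM] := eqVneq (mu u) u; first by rewrite !mE.
  by apply: (muE (mu u) u); rewrite (setUC [set mu u]) uM.
- by rewrite inE.
- by move/muM/sME; rewrite edge_adj.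
have uop x y : (mu x == x) || pref I x y (mu x) -> unmatched_or_prefers I M x y.
  rewrite /unmatched_or_prefers; have [mux _|nmux /= px] := eqVneq (mu x) x; last first.
    by apply/orP; right; apply/existsP; exists (mu x); rewrite px muM.
  apply/orP; left; apply/negP => /bigcupP[e eM xe].
  have := sME _ eM; rewrite inE => /existsP[a /existsP[b /andP[ab /eqP eE]]].
  have nab : a != b by apply: contraTneq ab => ->; rewrite adj_irr.
  rewrite eE in eM xe; case/set2P: xe => xE; rewrite xE in mux.
    by rewrite (muE _ _ eM) in mux; rewrite mux eqxx in nab.
  by rewrite setUC in eM; rewrite (muE _ _ eM) in mux; rewrite mux eqxx in nab.
apply: contraNN (stM u v) => /andP[/uop pu /uop pv].
rewrite /blocking uv pu pv !andbT /=.
by apply: contraNN nuv => /muE->.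
Qed.
End Partner.

(** The partner map of [delete I S] is extended by the identity, so deleted vertices look unmatched
    and the comparison with [pi] takes place on [V]. *)
Lemma removable_partner (V : finType) (I : roommates V) (S : {set V}) :
  removable I S -> exists mu, stable_partner I mu S.
Proof.
case=> M /stable_matching_partner[mu [muK _ mu_adj mu_st]].
pose nu v := if insub v is Some w then val (mu w) else v.
have nuT (w : {x : V | x \notin S}) : nu (val w) = val (mu w).
  by rewrite /nu valK.
have nuF v : v \in S -> nu v = v by move=> vS; rewrite /nu insubN // vS.
have subE v (vS : v \notin S) : v = val (exist _ v vS : {x | x \notin S}) by [].
exists nu; split=> [v|v|v|u v uS vS uv nuv].
- have [vS|vS] := boolP (v \in S); first by rewrite !nuF.
  by rewrite (subE _ vS) !nuT muK.
- by apply: contraNN => /nuF->.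
- have [/nuF->|vS] := boolP (v \in S); first by rewrite eqxx.
  by rewrite (subE _ vS) !nuT => nv; apply: (mu_adj (exist _ v vS)).
move: uv nuv; rewrite (subE _ uS) (subE _ vS) !nuT => uv nuv.
by apply: (mu_st (exist _ u uS) (exist _ v vS)); rewrite ?inE.
Qed.

(** * A stable partition against a stable matching *)

Section LowerBound.
Variables (V : finType) (I : roommates V) (pi : {perm V}) (S : {set V}) (mu : V -> V).
Hypotheses (pi_stable : stable_partition I pi) (mu_stable : stable_partner I mu S).

Let q u := (pi^-1)%g u.

Let piK : cancel pi q. Proof. exact: permK. Qed.
Let qK : cancel q pi. Proof. exact: permKV. Qed.

Lemma prev_fixed u : (q u == u) = (pi u == u).
Proof. by rewrite -(inj_eq (perm_inj (s := pi))) qK eq_sym. Qed.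

(** A fixed point of [pi] is high as soon as it has a partner, and it is never low. *)
Definition high := [set u | [&& mu u != u, mu u != pi u
  & (pi u == u) || pref I u (mu u) (q u)]].
Definition low := [set u | [&& u \notin S, pi u != u
  & (mu u == u) || pref I u (q u) (mu u)]].

Lemma adj_next u : pi u != u -> adj I u (pi u).
Proof. by case: pi_stable => /(_ u) + _ => /[apply] -[]. Qed.

Lemma adj_prev u : pi u != u -> adj I u (q u).
Proof. by case: pi_stable => /(_ u) + _ => /[apply] -[]. Qed.

(** Stability of [pi] on the edge from [u] to [mu u] makes [mu u] prefer its own predecessor to
    [u]. *)
Lemma high_low u : u \in high -> mu u \in low.
Proof.
rewrite inE => /and3P[nmu nmp pu]; have [muK muS mu_adj _] := mu_stable.
have [npm qm] : pi (mu u) != mu u /\ pref I (mu u) (q (mu u)) u.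
  by case: pi_stable => _; apply; rewrite ?mu_adj.
by rewrite inE muK npm qm orbT muS // muK eq_sym.
Qed.

Lemma card_high_low : #|high| <= #|low|.
Proof.
have [muK _ _ _] := mu_stable.
rewrite -(card_imset (mem high) (can_inj muK)); apply: subset_leq_card.
by apply/subsetP => _ /imsetP[u uH ->]; apply: high_low.
Qed.

(** The edge between [w] and [v = q w] does not block [mu] although [w] wants it; so [v], if not in
    [S], has a partner better than [w = pi v], hence better than [q v]. *)
Lemma low_prev w : w \in low -> q w \in S :|: high.
Proof.
rewrite !inE => /and3P[wS npw lw]; have [muK muS mu_adj mu_st] := mu_stable.
have [//|vS] := boolP (q w \in S); set v := q w in vS *.
have wv : adj I w v by apply: adj_prev.
have pv : pi v = w by apply: qK.
have npv : pi v != v by rewrite pv eq_sym prev_fixed.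
have nvw : mu v != w.
  apply/eqP => vw; have wE : mu w = v by rewrite -vw muK.
  case/orP: lw; rewrite wE ?(pref_irr wv) // => /eqP vw'.
  by rewrite pv vw' eqxx in npv.
have vw : adj I v w by rewrite adj_sym.
have := mu_st v w vS wS vw nvw; rewrite lw andbT negb_or => /andP[nmv nvp].
have vm := mu_adj v nmv.
rewrite nmv pv nvw /=; apply/orP; right.
have pm : pref I v (mu v) w.
  by have := pref_total vw vm; rewrite eq_sym (negbTE nvp) /=; apply.
have [wq|nwq] := eqVneq w (q v); first by rewrite -wq.
apply: pref_trans pm _ => //; first exact: adj_prev.
by case: pi_stable => /(_ v npv) [_ _]; rewrite pv => /(_ nwq).
Qed.

Lemma low_disjoint u : u \in low -> u \notin S :|: high.
Proof.
rewrite !inE negb_or => /and3P[-> npu lu] /=; apply/and3P => -[nmu nmp].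
rewrite (negbTE npu) (negbTE nmu) /= in lu * => hu.
have [_ _ mu_adj _] := mu_stable.
exact: pref_asym (mu_adj u nmu) (adj_prev npu) hu lu.
Qed.

Definition excess := (S :|: high) :\: [set q w | w in low].

(** As [q] maps [low] injectively into [S :|: high], the cardinal is [#|S :|: high| - #|low|], and
    [high] is no larger than [low]. *)
Lemma card_excess : #|excess| <= #|S|.
Proof.
have q_inj : injective q by apply: perm_inj.
have sub : [set q w | w in low] \subset S :|: high.
  by apply/subsetP => _ /imsetP[w wL ->]; apply: low_prev.
rewrite cardsD (setIidPr sub) card_imset // leq_subLR addnC.
rewrite (leq_trans (leq_card_setU _ _)) // leq_add2l.
exact: card_high_low.
Qed.

Lemma porbit_pi x u : (pi u \in porbit pi x) = (u \in porbit pi x).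
Proof. by rewrite -!eq_porbit_mem; congr (_ == _); apply: porbit_perm 1 u. Qed.

(** Without excess on the cycle, the map [t] below pairs a low vertex with its predecessor and the
    other vertices by [mu]. It is an involution without fixed points, so the cycle is even. *)
Lemma odd_porbit_excess x : pi x != x -> odd #|porbit pi x| ->
  exists2 y, y \in porbit pi x & y \in excess.
Proof.
move=> npx oddx; apply/exists_inP; apply: contraTT oddx.
rewrite negb_exists_in => /forall_inP no_excess.
have porbit_q u : (q u \in porbit pi x) = (u \in porbit pi x).
  by rewrite -porbit_pi qK.
have npi u : u \in porbit pi x -> pi u != u.
  rewrite porbit_sym => /porbitP[i xE]; apply: contra npx => /eqP pu.
  by rewrite xE permX iter_fix // pu.
have tight u : u \in porbit pi x -> u \in S :|: high -> pi u \in low.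
  move=> /no_excess; rewrite inE negb_and negbK => /orP[/imsetP[w wL ->]|/negbTE->//].
  by rewrite qK.
have [muK muS mu_adj mu_st] := mu_stable.
pose t u := if u \in low then q u else if pi u \in low then pi u else mu u.
(* Such a vertex is outside [S] and neither high nor low; since preferences are strict, its partner
   is a neighbour on the cycle. *)
have rest u : u \in porbit pi x -> u \notin low -> pi u \notin low ->
    mu u != u /\ (mu u = pi u \/ mu u = q u).
  move=> ux uL puL; have : u \notin S :|: high by apply: contra puL => /(tight u ux).
  have npu := npi u ux; rewrite !inE negb_or => /andP[uS].
  move: uL; rewrite inE uS npu (negbTE npu) /= negb_or => /andP[nmu nqm].
  rewrite nmu /= negb_and negbK => /orP[/eqP|nmq]; first by split=> //; left.
  split=> //; right; apply/eqP/negPn/negP => nmq'.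
  have := pref_total (mu_adj u nmu) (adj_prev npu) nmq'.
  by rewrite (negbTE nmq) (negbTE nqm).
apply: (@even_card_involution _ _ t) => u ux; rewrite /t.
have [uL|uL] := boolP (u \in low).
  rewrite porbit_q ux prev_fixed npi // qK uL.
  (* [q u] is in [S :|: high], hence not low, so the second branch of [t] sends it back. *)
  by rewrite (negbTE (contraL (@low_disjoint (q u)) (low_prev uL))).
have [puL|puL] := boolP (pi u \in low).
  by rewrite porbit_pi ux puL piK npi.
have [nmu mu_pq] := rest u ux uL puL.
have mux : mu u \in porbit pi x by case: mu_pq => ->; rewrite ?porbit_pi ?porbit_q.
have muSH : mu u \notin S :|: high.
  rewrite inE negb_or muS ?muK 1?eq_sym //=.
  by apply: contra uL => /high_low; rewrite muK.
(* [pi u] is not low by assumption. If [mu u = q u] were low, it would prefer its predecessor to its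
   successor [u]. *)
have muL : mu u \notin low.
  case: mu_pq => [->//|mq]; apply/negP; rewrite inE muK mq => /and3P[_ npq].
  have [qu qqu pu] : [/\ adj I (q u) u, adj I (q u) (q (q u))
      & u != q (q u) -> pref I (q u) u (q (q u))].
    by case: pi_stable => /(_ _ npq); rewrite qK.
  rewrite eq_sym prev_fixed (negbTE (npi u ux)) /= => up.
  have [uE|/pu] := eqVneq u (q (q u)); last exact: pref_asym.
  by rewrite -uE (pref_irr qu) in up.
have pmuL : pi (mu u) \notin low.
  by apply: contra muSH => /low_prev; rewrite piK.
by rewrite (negbTE muL) (negbTE pmuL) muK.
Qed.

(** The cycles through [D] are distinct and each meets [excess]. *)
Lemma card_odd_porbits (D : {set V}) :
  {in D, forall d, odd #|porbit pi d| && (2 < #|porbit pi d|)} ->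
  {in D &, injective (porbit pi)} -> #|D| <= #|S|.
Proof.
move=> oddD injD; rewrite (leq_trans _ card_excess) //.
rewrite -(card_in_imset injD) (leq_trans _ (leq_imset_card (porbit pi) _)) //.
apply/subset_leq_card/subsetP => _ /imsetP[d dD ->].
have /andP[odd_d gt2] := oddD d dD.
have npd : pi d != d.
  have := uniq_traject_porbit pi d; case: #|_| gt2 => [|[|n]] //= _.
  by rewrite inE negb_or eq_sym => /andP[/andP[]].
have [y yd yQ] := odd_porbit_excess npd odd_d.
by apply/imsetP; exists y => //; apply/eqP; rewrite eq_porbit_mem porbit_sym.
Qed.

End LowerBound.

(** * The matching on the remaining vertices *)

Section Deletion.
Variables (V : finType) (I : roommates V) (pi : {perm V}).

Lemma porbit_gt1 v : (1 < #|porbit pi v|) = (pi v != v).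
Proof.
apply/idP/idP => [gt1|npv].
  have := uniq_traject_porbit pi v; case: #|_| gt1 => [|[|n]] //= _.
  by rewrite inE negb_or eq_sym => /andP[/andP[]].
apply: (@leq_trans #|[set v; pi v]|); first by rewrite cards2 eq_sym npv.
apply/subset_leq_card/subsetP => w /set2P[] ->; first exact: porbit_id.
exact: (mem_porbit pi 1).
Qed.

Lemma porbit_same u v : u \in porbit pi v -> porbit pi u = porbit pi v.
Proof. by rewrite -eq_porbit_mem => /eqP. Qed.

Lemma value_cycle_porbit x : exists n,
  [/\ value (cycle_from (fun y => tick (pi y)) x) = traject pi x n,
      uniq (traject pi x n), traject pi x n =i porbit pi x & n = #|porbit pi x|].
Proof.
have [|m [m_gt0 iter_m um ->]] := @value_cycle_from V (fun y => tick (pi y)) x.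
  by exists #|porbit pi x|; [rewrite lt0n card_porbit_neq0 | apply: iter_porbit].
have mem_m : traject pi x m =i porbit pi x.
  move=> y; apply/(cyclic_trajectP _ m_gt0 iter_m)/porbitP => -[i ->]; exists i;
    by rewrite permX.
exists m; split=> //.
by rewrite -(size_traject pi x m) -(card_uniqP um); apply: eq_card.
Qed.

(** The even length leaves no vertex over. That each edge joins some [a] to [pi a] is kept for the
    proof of stability. *)
Lemma pair_up_traject k v (M : {set {set V}}) :
  uniq (traject pi v k.*2) -> {in traject pi v k.*2, forall w, w \notin cover M} ->
  trivIset M -> (forall e, e \in M -> exists a, e = [set a; pi a]) ->
  let M' := value (pair_up (traject pi v k.*2) M) in
  [/\ cover M' = cover M :|: [set w in traject pi v k.*2], trivIset M'
    & forall e, e \in M' -> exists a, e = [set a; pi a]].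
Proof.
elim: k v M => [|k IHk] v M /=.
  by move=> _ _ trivM pairs; split=> //; apply/setP=> w; rewrite !inE orbF.
rewrite !inE negb_or => /and3P[/andP[vp vt] pt ut] disj trivM pairs.
have coverM1 : cover ([set v; pi v] |: M) = [set v; pi v] :|: cover M.
  by rewrite /cover bigcup_setU big_set1.
have vM : v \notin cover M by apply: disj; rewrite inE eqxx.
have pM : pi v \notin cover M by apply: disj; rewrite !inE eqxx orbT.
have disjM e : e \in M -> [disjoint [set v; pi v] & e].
  move=> eM; apply/pred0P => w /=; apply/negP => /andP[/set2P[]-> we].
    by move/negP: vM; apply; apply/bigcupP; exists e.
  by move/negP: pM; apply; apply/bigcupP; exists e.
rewrite value_bind /=; have [| | |] := IHk (pi (pi v)) ([set v; pi v] |: M) ut.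
- move=> w wt; have wM : w \notin cover M by apply: disj; rewrite !inE wt !orbT.
  rewrite coverM1 in_setU negb_or wM andbT.
  by apply/negP => /set2P[] wE; rewrite wE in wt; [rewrite wt in vt | rewrite wt in pt].
- apply/trivIsetP => A B /setU1P[->|AM] /setU1P[->|BM]; rewrite ?eqxx // => nAB.
  + exact: disjM.
  + by rewrite disjoint_sym disjM.
  + exact: (trivIsetP trivM).
- by move=> e /setU1P[->|/pairs//]; exists v.
move=> coverM' trivM' pairs'; split=> //; rewrite coverM' coverM1.
apply/setP=> w; rewrite !inE.
by case: (w == v); case: (w == pi v); case: (w \in cover M).
Qed.

(** Fixed points of [pi] stay unmatched without being deleted. The covered vertices and the form of
    the edges are all that stability will need of [M]. *)
Definition deletion_inv (st : {set V} * {set V} * {set {set V}}) :=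
  let: (seen, D, M) := st in
  [/\ {in seen, forall v, porbit pi v \subset seen}, D \subset seen,
      {in D, forall d, odd #|porbit pi d| && (2 < #|porbit pi d|)}
        /\ {in D &, injective (porbit pi)},
      cover M = [set v in seen | (pi v != v) && (v \notin D)]
    & trivIset M /\ forall e, e \in M -> exists a, e = [set a; pi a]].

Variable start : seq V -> nat.

(** The loop body of [vertex_deletion], named to state the invariant for one iteration. *)
Definition deletion_step x (st : {set V} * {set V} * {set {set V}}) :=
  let step x := tick (pi x) in
  let: (seen, D, M) := st in
  let! old := tick (x \in seen) in
  if old then ret st else
  let! c := cycle_from step x in
  let! v0 := ticks (size c) (nth x c (start c)) in
  let! c := cycle_from step v0 in
  let! seen := for_each c (fun y (seen : {set V}) => tick (y |: seen)) seen in
  let! n := ticks (size c) (size c) in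
  if odd n then
    if 2 < n then
      let! D := tick (v0 |: D) in
      let! M := pair_up (behead c) M in
      ret (seen, D, M)
    else ret (seen, D, M)
  else
    let! M := pair_up c M in
    ret (seen, D, M).

(** [seen] is closed under cycles, so the cycle of an unseen [x] is disjoint from it. Its length is
    even, odd and at least 3, or 1. *)
Lemma deletion_stepP x st : deletion_inv st ->
  let st' := value (deletion_step x st) in
  [/\ deletion_inv st', st.1.1 \subset st'.1.1 & x \in st'.1.1].
Proof.
case: st => [[seen D] M] inv; rewrite /deletion_step value_bind /=.
case: ifP => [xseen //|/negbT xseen].
have [closed sD [oddD injD] coverM [trivM pairs]] := inv.
have [n0 [cE _ mem_c _]] := value_cycle_porbit x.
rewrite value_bind cE value_bind /=; set v0 := nth x _ _.
(* A position out of range falls back on [x], so [v0] is always on the cycle. *)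
have v0x : v0 \in porbit pi x.
  rewrite -mem_c /v0; set c := traject _ _ _ in mem_c *.
  have [lt|ge] := ltnP (start c) (size c); first exact: mem_nth.
  by rewrite nth_default // mem_c porbit_id.
have [n [{}cE uc {}mem_c nE]] := value_cycle_porbit v0.
rewrite value_bind cE value_bind value_for_each; set seen' := foldl _ _ _.
have seenE v : (v \in seen') = (v \in seen) || (v \in porbit pi v0).
  rewrite -mem_c /seen'.
  elim: (traject _ _ _) seen {seen' closed sD coverM xseen inv} => [|y s IHs] A /=.
    by rewrite orbF.
  by rewrite IHs !inE orbCA orbA.
have disj v : v \in porbit pi v0 -> v \notin seen.
  move=> vv0; apply: contra xseen => /closed/subsetP; apply.
  by rewrite (porbit_same vv0) (porbit_same v0x) porbit_id.
have closed' : {in seen', forall v, porbit pi v \subset seen'}.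
  move=> v; rewrite seenE => /orP[vs|vv0]; apply/subsetP => w wv; rewrite seenE.
    by rewrite (subsetP (closed v vs)).
  by rewrite -(porbit_same vv0) wv orbT.
have seen_sub : seen \subset seen' by apply/subsetP => v vs; rewrite seenE vs.
have xseen' : x \in seen' by rewrite seenE porbit_sym v0x orbT.
have sD' : D \subset seen' by apply: subset_trans seen_sub.
have disjM v : v \in porbit pi v0 -> v \notin cover M.
  by move/disj; apply: contra; rewrite coverM inE => /andP[].
have fixE v : v \in porbit pi v0 -> (pi v != v) = (1 < n).
  by move/porbit_same => vE; rewrite -porbit_gt1 vE nE.
have n_gt0 : 0 < n by rewrite nE lt0n card_porbit_neq0.
have notD v : v \in porbit pi v0 -> v \notin D.
  by move/disj; apply: contra => /(subsetP sD).
rewrite value_bind /= size_traject.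
have [odd_n|even_n] := boolP (odd n); last first.
  rewrite value_bind; have nk : n = n./2.*2 by rewrite -[LHS]odd_double_half (negbTE even_n).
  have gt1 : 1 < n by case: (n) n_gt0 even_n => [|[|]].
  have [||||coverM' trivM' pairs'] := @pair_up_traject n./2 v0 M; rewrite -?nk //.
    by move=> w; rewrite mem_c; apply: disjM.
  rewrite -nk in coverM' trivM' pairs'.
  split=> //; split=> //=; rewrite coverM' coverM; apply/setP=> v.
  rewrite !inE seenE mem_c; have [vv0|nvv0] := boolP (v \in porbit pi v0).
    by rewrite fixE // gt1 notD // !orbT.
  by rewrite !orbF.
case: ifP => [gt2|]; last first.
  move=> le2; split=> //; split=> //=; rewrite coverM; apply/setP=> v.
  rewrite !inE seenE; have [vv0|_] := boolP (v \in porbit pi v0); last by rewrite orbF.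
  rewrite fixE // (negbTE (disj v vv0)) /=.
  by case: (n) odd_n le2 => [|[|[|]]].
(* Without [v0], an even number [n.-1] of vertices remains, paired from [pi v0] on. *)
rewrite value_bind /= value_bind; have nk : n.-1 = (n.-1)./2.*2.
  by rewrite -[LHS]odd_double_half; case: (n) odd_n n_gt0 => //= k /negbTE->.
have nS : n = n.-1.+1 by rewrite prednK.
have beheadE : behead (traject pi v0 n) = traject pi (pi v0) n.-1 by rewrite nS.
have mem_b v : (v \in porbit pi v0) = (v == v0) || (v \in traject pi (pi v0) n.-1).
  by rewrite -mem_c {1}nS inE.
have [v0b ub] : v0 \notin traject pi (pi v0) n.-1 /\ uniq (traject pi (pi v0) n.-1).
  by move: uc; rewrite nS /= => /andP[].
have [||||coverM' trivM' pairs'] := @pair_up_traject (n.-1)./2 (pi v0) M; rewrite -?nk //.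
  by move=> w wb; apply: disjM; rewrite mem_b wb orbT.
rewrite -nk -beheadE in coverM' trivM' pairs'.
split=> //; split=> //=.
- apply/subsetP => v /setU1P[->|/(subsetP sD')//].
  by rewrite seenE porbit_id orbT.
- split=> [d /setU1P[->|/oddD//]|]; first by rewrite -nE odd_n.
  have neqD d : d \in D -> porbit pi v0 <> porbit pi d.
    by move=> dD eqp; move: (notD d); rewrite eqp porbit_id dD => /(_ isT).
  move=> d d' /setU1P[->|dD] /setU1P[->|d'D] // eqp.
  + by case: (neqD d').
  + by case: (neqD d).
  + exact: injD.
rewrite coverM' coverM beheadE; apply/setP=> v.
rewrite !inE seenE mem_b negb_or.
have [->|nvv0] /= := eqVneq v v0.
  by rewrite (negbTE v0b) (negbTE (disj v0 (porbit_id _ _))) !andbF.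
have [vb|nvb] := boolP (v \in traject pi (pi v0) n.-1); last by rewrite !orbF.
have vv0 : v \in porbit pi v0 by rewrite mem_b vb orbT.
by rewrite !orbT fixE // notD // (leq_trans _ gt2).
Qed.

End Deletion.

(** * Correctness of the deletion algorithm *)

Section Correctness.
Variables (V : finType) (I : roommates V) (pi : {perm V}).
Hypothesis pi_stable : stable_partition I pi.

(** A remaining vertex moved by [pi] is matched to its successor or predecessor, so in a blocking
    edge it prefers the other end to its predecessor. For both ends of an edge this contradicts the
    stability of [pi]. *)
Lemma removable_of_pairs (D : {set V}) (M : {set {set V}}) :
  cover M = [set v | (pi v != v) && (v \notin D)] -> trivIset M ->
  (forall e, e \in M -> exists a, e = [set a; pi a]) -> removable I D.
Proof.
move=> coverM trivM pairs.
pose W : finType := {x : V | x \notin D}.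
pose M' := [set e : {set W} | val @: e \in M].
have inM v : (v \in cover M) = (pi v != v) && (v \notin D) by rewrite coverM inE.
have pair_adj a : [set a; pi a] \in M -> adj I a (pi a).
  move=> aM; apply: (adj_next pi_stable).
  have : a \in cover M by apply/bigcupP; exists [set a; pi a]; rewrite ?set21.
  by rewrite inM => /andP[].
have imset_pair (u w : W) : val @: [set u; w] = [set val u; val w].
  by rewrite imsetU1 imset_set1.
have matM' : matching (delete I D) M'.
  apply/andP; split.
    apply/subsetP => e; rewrite inE => eM; have [a eE] := pairs _ eM.
    have /imsetP[w1 _ aE] : a \in val @: e by rewrite eE set21.
    have /imsetP[w2 _ pE] : pi a \in val @: e by rewrite eE set22.
    have -> : e = [set w1; w2].
      by apply: (imset_inj val_inj); rewrite imset_pair -aE -pE.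
    rewrite edge_adj /= -aE -pE; apply: pair_adj; rewrite -eE; exact: eM.
  apply/trivIsetP => A B; rewrite !inE => AM BM nAB.
  have nAB' : val @: A != val @: B by rewrite (inj_eq (imset_inj val_inj)).
  have dis := trivIsetP trivM _ _ AM BM nAB'.
  apply/pred0P => w /=; apply/negP => /andP[wA wB].
  by have := disjointFr dis (imset_f val wA); rewrite imset_f.
exists M'; split=> // u v; apply/negP => /and4P[uv _ uopu uopv].
have prefers (w z : W) : pi (val w) != val w -> adj I (val w) (val z) ->
    unmatched_or_prefers (delete I D) M' w z ->
    pref I (val w) (val z) ((pi^-1)%g (val w)).
  move=> npw wz; rewrite /unmatched_or_prefers.
  have wM : val w \in cover M by rewrite inM npw (valP w).
  have -> : w \in cover M'.
    have /bigcupP[e eM we] := wM.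
    apply/bigcupP; exists (val @^-1: e : {set W}); last by rewrite inE.
    rewrite inE; suff -> : val @: (val @^-1: e : {set W}) = e by [].
    apply/setP=> x; apply/imsetP/idP => [[y]|xe]; first by rewrite inE => ? ->.
    have : x \in cover M by apply/bigcupP; exists e.
    rewrite inM => /andP[_ xD].
    by exists (exist _ x xD : W); rewrite ?inE.
  case/existsP=> y /andP[]; rewrite inE imset_pair => yM /= zy.
  have [adj_n adj_p np] : [/\ adj I (val w) (pi (val w)), adj I (val w) ((pi^-1)%g (val w))
      & pi (val w) != (pi^-1)%g (val w) -> pref I (val w) (pi (val w)) ((pi^-1)%g (val w))].
    by case: pi_stable => /(_ _ npw).
  have [a yE] := pairs _ yM.
  have nyw : val y != val w.
    apply/eqP => yw; have : pi a \in [set val w; val y] by rewrite yE set22.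
    have : a \in [set val w; val y] by rewrite yE set21.
    rewrite yw setUid => /set1P-> /set1P pw.
    by rewrite pw eqxx in npw.
  have [yp|yq] : val y = pi (val w) \/ val y = (pi^-1)%g (val w).
    have : val w \in [set a; pi a] by rewrite -yE set21.
    have : val y \in [set a; pi a] by rewrite -yE set22.
    case/set2P=> yE' /set2P[] wE; rewrite yE' wE ?permK; auto.
      by rewrite yE' wE eqxx in nyw.
    by rewrite yE' wE eqxx in nyw.
  - rewrite yp in zy; have [<-//|/np pq] := eqVneq (pi (val w)) ((pi^-1)%g (val w)).
    exact: pref_trans zy pq.
  - by rewrite yq in zy.
have uv' : adj I (val v) (val u) by rewrite adj_sym.
(* Stability of [pi] makes [v] prefer its predecessor to [u], whereas blocking makes it prefer
   [u]. *)
have nuv : val v != pi (val u) ->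
    (pi (val u) == val u) || pref I (val u) (val v) ((pi^-1)%g (val u)) -> False.
  move=> nvp hu; have [npv pv] := pi_stable.2 _ _ uv nvp hu.
  exact: pref_asym uv' (adj_prev pi_stable npv) (prefers v u npv uv' uopv) pv.
have [pu|npu] := eqVneq (pi (val u)) (val u).
  apply: nuv; last by rewrite pu eqxx.
  by rewrite pu; apply: contraTneq uv => eqv; rewrite /= eqv adj_irr.
have pu := prefers u v npu uv uopu.
have [vE|nvp] := eqVneq (val v) (pi (val u)); last by apply: nuv; rewrite // pu orbT.
have npv : pi (val v) != val v by rewrite vE (inj_eq perm_inj).
(* Here [u] is the predecessor of [v] and would be preferred to itself. *)
by have := prefers v u npv uv' uopv; rewrite vE permK -vE (pref_irr uv').
Qed.

(** Once all vertices are seen, the invariant feeds [removable_of_pairs] for removability and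
    [card_odd_porbits] for minimality. *)
Lemma smallest_removable_deletion start (find : timed {perm V}) :
  value find = pi -> smallest_removable I (value (vertex_deletion find start)).1.
Proof.
move=> findE; rewrite /vertex_deletion value_bind findE value_bind value_for_each.
set st := foldl _ _ _.
have [inv seenT] : deletion_inv pi st /\ forall v, v \in st.1.1.
  rewrite /st; have : deletion_inv pi (set0, set0, set0).
    split=> //; rewrite ?sub0set //; try by [move=> ?; rewrite inE | split=> ?; rewrite inE].
    - by apply/setP=> v; rewrite /cover big_set0 !inE.
    - by split=> [|e]; [apply/trivIsetP => A B|]; rewrite inE.
  suff loop s st0 : deletion_inv pi st0 ->
      let st1 := foldl (fun st x => value (deletion_step pi start x st)) st0 s in
      [/\ deletion_inv pi st1, st0.1.1 \subset st1.1.1 & {subset s <= st1.1.1}].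
    by case/(loop (enum V)) => ? _ /(_ _ (mem_enum _ _)).
  elim: s st0 => [|x s IHs] st0 inv0 //=.
  have [inv1 sub1 x1] := deletion_stepP start x inv0.
  have [inv2 sub2 s2] := IHs _ inv1; split=> //; first exact: subset_trans sub2.
  by move=> y /predU1P[->|/s2//]; apply: (subsetP sub2).
case: st inv seenT => -[seen D] M /= [_ _ [oddD injD] coverM [trivM pairs]] seenT.
have seenE : seen = setT by apply/setP=> v; rewrite inE seenT.
split.
  apply: removable_of_pairs trivM pairs; rewrite coverM seenE.
  by apply/setP=> v; rewrite !inE.
move=> S /removable_partner[mu mu_stable].
exact: (card_odd_porbits pi_stable mu_stable).
Qed.
End Correctness.

(** * Running time *)

Lemma time_for_each X A (s : seq X) (body : X -> A -> timed A) a b :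
  (forall x a, time (body x a) <= b) -> time (for_each s body a) <= size s * b.+1.
Proof.
move=> le_b; elim: s a => //= x s IHs a; rewrite !time_bind /=.
by have := le_b x a; have := IHs (value (body x a)); lia.
Qed.

Lemma size_for_each X Y (s : seq X) (body : X -> seq Y -> timed (seq Y)) a :
  (forall x a, size (value (body x a)) <= (size a).+1) ->
  size (value (for_each s body a)) <= size a + size s.
Proof.
rewrite value_for_each => le1; elim: s a => [|x s IHs] a /=; first by rewrite addn0.
by have := le1 x a; have := IHs (value (body x a)); lia.
Qed.

Section Cost.
Variable V : finType.
Let n := #|V|.

Section Table.
Variable I : roommates V.

Lemma size_insert u v s : size (value (insert I u v s)) = (size s).+1.
Proof.
elim: s => //= w s IHs; rewrite !value_bind /=; case: ifP => //= _.
by rewrite value_bind /= IHs.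
Qed.

Lemma time_insert u v s : time (insert I u v s) <= (size s).*2.+1.
Proof.
elim: s => //= w s IHs; rewrite !time_bind /=; case: ifP => //= _.
by rewrite time_bind /=; lia.
Qed.

Lemma size_row T u : size (value (row I T u)) <= n.
Proof.
rewrite /n cardE -[X in _ <= X]add0n; apply: size_for_each => v s.
by rewrite value_bind /=; case: ifP => _ /=; rewrite ?size_insert.
Qed.

Definition row_cost k := k * (k.*2 + 3).

Lemma time_row T u : time (row I T u) <= row_cost n.
Proof.
rewrite /row_cost /n cardE /row; set body := fun _ _ => _.
(* The list grows by at most one entry per iteration, so [size s + size l] bounds its length
   throughout. *)
suff loop l s : time (for_each l body s) <= size l * ((size s + size l).*2 + 3).
  exact: loop.
elim: l s => //= v l IHl s; rewrite 2!time_bind.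
have tb : time (body v s) <= (size s).*2.+2.
  rewrite /body time_bind /=; case: ifP => _ //=.
  by have := time_insert u v s; lia.
have sb : size (value (body v s)) <= (size s).+1.
  by rewrite value_bind /=; case: ifP => _ /=; rewrite ?size_insert.
have := IHl (value (body v s)); rewrite /=.
have : size l * ((size (value (body v s)) + size l).*2 + 3)
       <= size l * ((size s + (size l).+1).*2 + 3).
  by rewrite leq_mul2l; apply/orP; right; lia.
lia.
Qed.

Lemma time_full_table : time (full_table I) <= n * (n * 3).+1.
Proof.
rewrite {1}/n cardE; apply: time_for_each => u T; rewrite {1}/n cardE.
by apply: time_for_each => v T'; rewrite time_bind /=; case: ifP.
Qed.

Lemma time_truncate y x T : time (truncate I y x T) <= n * 5.
Proof.
rewrite {1}/n cardE; apply: time_for_each => z T'.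
by rewrite !time_bind /=; case: ifP.
Qed.

Definition propose_cost k := k * (row_cost k + k * 5).+1.

Lemma time_propose T : time (propose I T) <= propose_cost n.
Proof.
rewrite /propose_cost {1}/n cardE; apply: time_for_each => x T'.
rewrite time_bind; apply: leq_add; first exact: time_row.
by case: (value _) => //= y s; apply: time_truncate.
Qed.

Lemma time_second_entry T x : time (second_entry I T x) <= (row_cost n).+1.
Proof. by rewrite /second_entry time_bind /= addn1 ltnS time_row. Qed.

Definition next_cost k := (row_cost k).+1 + (row_cost k + k).

Lemma time_next T x : time (Defs.next I T x) <= next_cost n.
Proof.
rewrite /Defs.next time_bind; apply: leq_add; first exact: time_second_entry.
rewrite time_bind; apply: leq_add; first exact: time_row.
exact: size_row.
Qed.

Lemma time_find_long T : time (find_long I T) <= n * (row_cost n + n.+2).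
Proof.
rewrite addnS {1}/n cardE; apply: time_for_each => u o.
rewrite time_bind; apply: leq_add; first exact: time_row.
by rewrite time_bind /=; have := size_row T u; case: ifP => _ /=; lia.
Qed.

Lemma time_first_entries T : time (first_entries I T) <= n + n * (row_cost n).+2.
Proof.
rewrite /first_entries time_bind leq_add2l {1}/n cardE; apply: time_for_each => u f.
by rewrite time_bind /= addn1 ltnS time_row.
Qed.
End Table.

Definition rounds_cost k b := k * (k * b.+1).+1.

Lemma time_rounds body (T : table V) b :
  (forall T, time (body T) <= b) -> time (rounds body T) <= rounds_cost n b.
Proof.
move=> le_b; rewrite /rounds_cost {1}/n cardE; apply: time_for_each => _ T'.
by rewrite {1}/n cardE; apply: time_for_each => _.
Qed.

Section Cycle.
Variables (f : V -> timed V) (b : nat).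
Hypothesis le_b : forall x, time (f x) <= b.

Lemma time_walk r x k : time (walk f r x k) <= k * b.+2.
Proof.
elim: k x => //= k IHk x; rewrite time_bind /=; case: ifP => //= _.
by rewrite !time_bind /=; have := le_b x; have := IHk (value (f x)); lia.
Qed.

Lemma size_walk r x k : size (value (walk f r x k)) <= k.
Proof.
elim: k x => //= k IHk x; rewrite value_bind /=; case: ifP => //= _.
by rewrite !value_bind /= ltnS.
Qed.

Definition cycle_cost k b := b + (k * b.+2).+1.

Lemma time_cycle_from r : time (cycle_from f r) <= cycle_cost n b.
Proof.
rewrite /cycle_from !time_bind /=; have := le_b r.
have := time_walk r (value (f r)) n; rewrite /cycle_cost -/n; lia.
Qed.

Lemma size_cycle_from r : size (value (cycle_from f r)) <= n.+1.
Proof. by rewrite /cycle_from !value_bind /= ltnS size_walk. Qed.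
End Cycle.

Section Algorithms.
Variable I : roommates V.

Definition eliminate_cost k :=
  k * (row_cost k + k.+2) + (k * (next_cost k).+1 + (cycle_cost k (next_cost k)
  + (k.+1 * (row_cost k).+3 + k.+1 * (k * 5).+1))).

Lemma time_eliminate T : time (eliminate I T) <= eliminate_cost n.
Proof.
rewrite /eliminate time_bind; apply: leq_add; first exact: time_find_long.
case: (value _) => //= u; rewrite time_bind; apply: leq_add.
  by rewrite {1}/n cardE; apply: time_for_each => _ x; apply: time_next.
rewrite time_bind; apply: leq_add.
  by apply: time_cycle_from => x; apply: time_next.
set xs := value (cycle_from _ _).
have xs_n : size xs <= n.+1 by apply: size_cycle_from.
rewrite time_bind; apply: leq_add.
  apply: (@leq_trans (size xs * (row_cost n).+3)); last by rewrite leq_mul2r xs_n orbT.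
  by apply: time_for_each => x ps; rewrite time_bind /= addn1 ltnS time_second_entry.
set ps := value _; have ps_n : size ps <= n.+1.
  by apply: leq_trans (size_for_each _ _ _) _ => // x ps0; rewrite value_bind.
apply: (@leq_trans (size ps * (n * 5).+1)); last by rewrite leq_mul2r ps_n orbT.
by apply: time_for_each => p T'; apply: time_truncate.
Qed.

Definition tan_cost k :=
  k * (k * 3).+1 + (rounds_cost k (propose_cost k)
  + (rounds_cost k (eliminate_cost k) + (k + k * (row_cost k).+2))).

Lemma time_tan : time (tan I) <= tan_cost n.
Proof.
rewrite /tan 4!time_bind /= addn0.
apply: leq_add; first exact: time_full_table.
apply: leq_add; first by apply: time_rounds => T; apply: time_propose.
apply: leq_add; first by apply: time_rounds => T; apply: time_eliminate.
exact: time_first_entries.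
Qed.
End Algorithms.

Lemma time_pair_up (s : seq V) M : time (pair_up s M) <= size s.
Proof.
have [k] := ubnP (size s); elim: k s M => // k IHk [|a [|b s]] M //= lek.
by rewrite time_bind /=; have := IHk s ([set a; b] |: M); lia.
Qed.

Definition deletion_cost k :=
  k * (1 + (cycle_cost k 1 + (k.+1 + (cycle_cost k 1 + (k.+1 * 2
    + (k.+1 + k.+2)))))).+1.

Lemma time_vertex_deletion (find : timed {perm V}) start :
  time (vertex_deletion find start) <= time find + deletion_cost n.
Proof.
rewrite /vertex_deletion time_bind leq_add2l time_bind.
set out := for_each _ _ _; case: (value out) => -[_ D] M /=; rewrite addn0 {}/out.
rewrite /deletion_cost {1}/n cardE; apply: time_for_each => x [[seen D'] M'].
rewrite time_bind leq_add2l; case: ifP => //= _.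
rewrite time_bind; apply: leq_add; first by apply: time_cycle_from.
set c := value _; have c_n : size c <= n.+1 by apply: size_cycle_from.
rewrite time_bind; apply: leq_add => //; set v0 := value _.
rewrite time_bind; apply: leq_add; first by apply: time_cycle_from.
set c' := value _; have c'_n : size c' <= n.+1 by apply: size_cycle_from.
rewrite time_bind; apply: leq_add.
  apply: (@leq_trans (size c' * 2)); last by rewrite leq_mul2r c'_n orbT.
  exact: time_for_each.
rewrite time_bind; apply: leq_add => //=.
have bh : size (behead c') <= size c' by rewrite size_behead leq_pred.
have t1 := time_pair_up (behead c') M'; have t2 := time_pair_up c' M'.
by case: ifP => _; [case: ifP => _ |]; rewrite ?time_bind /=; lia.
Qed.
End Cost.

(** * Polynomial bounds *)

Lemma leq_expl k a b : a <= b -> a ^ k <= b ^ k.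
Proof. by case: k => // k leab; rewrite leq_exp2r. Qed.

(** The base [n.+1] is positive, so a larger exponent is always weaker, even at [n = 0]; a sum can
    then use [k + l]. *)
Definition poly_bounded (f : nat -> nat) := exists c k, forall n, f n <= c * n.+1 ^ k.

Lemma poly_const a : poly_bounded (fun _ => a).
Proof. by exists a, 0 => n; rewrite muln1. Qed.

Lemma poly_id : poly_bounded (fun n => n).
Proof. by exists 1, 1 => n; rewrite mul1n. Qed.

Lemma poly_add f g : poly_bounded f -> poly_bounded g -> poly_bounded (fun n => f n + g n).
Proof.
case=> c [k fc] [d [l gd]]; exists (c + d), (k + l) => n; rewrite mulnDl expnD.
apply: leq_add; [apply: leq_trans (fc n) _ | apply: leq_trans (gd n) _].
  by rewrite leq_mul2l leq_pmulr ?expn_gt0 ?orbT.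
by rewrite leq_mul2l leq_pmull ?expn_gt0 ?orbT.
Qed.

Lemma poly_succ f : poly_bounded f -> poly_bounded (fun n => (f n).+1).
Proof.
move=> pf; have [c [k le]] := poly_add pf (poly_const 1).
by exists c, k => n; rewrite -addn1.
Qed.

Lemma poly_double f : poly_bounded f -> poly_bounded (fun n => (f n).*2).
Proof.
move=> pf; have [c [k le]] := poly_add pf pf.
by exists c, k => n; rewrite -addnn.
Qed.

Lemma poly_mul f g : poly_bounded f -> poly_bounded g -> poly_bounded (fun n => f n * g n).
Proof.
case=> c [k fc] [d [l gd]]; exists (c * d), (k + l) => n.
by rewrite expnD mulnACA leq_mul.
Qed.

Ltac poly := repeat first
  [ exact: poly_const | exact: poly_id | apply: poly_add | apply: poly_mul
  | apply: poly_succ | apply: poly_double ].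

Lemma poly_tan : poly_bounded tan_cost.
Proof.
rewrite /tan_cost /rounds_cost /eliminate_cost /propose_cost /cycle_cost /next_cost /row_cost.
poly.
Qed.

Lemma poly_deletion : poly_bounded deletion_cost.
Proof. rewrite /deletion_cost /cycle_cost; poly. Qed.

(** For [n > 0], [n.+1 <= 2 * n] gives the factor [2 ^ k]; the added constant handles [n = 0]. *)
Lemma poly_bound f : poly_bounded f -> exists c k, forall n, f n <= c * n ^ k + c.
Proof.
case=> c [k le]; exists (c * 2 ^ k), k => -[|n]; apply: leq_trans (le _) _.
  by rewrite exp1n muln1 -{1}[c]muln1 (leq_trans _ (leq_addl _ _)) // leq_mul ?expn_gt0.
rewrite (leq_trans _ (leq_addr _ _)) // -mulnA -expnMn leq_mul2l orbC leq_expl //.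
by lia.
Qed.

Lemma poly_monomial c k : poly_bounded (fun n => c * n ^ k + c).
Proof.
exists (c + c), k => n; rewrite mulnDl leq_add //.
  by rewrite leq_mul2l orbC leq_expl.
by rewrite leq_pmulr ?expn_gt0.
Qed.

(** * The algorithm with an arbitrary finder and with Tan's *)

Lemma deletion_correct (find : finder) :
  finds_stable_partitions find -> vertex_deletion_correct find.
Proof. by move=> find_ok V I start; apply: smallest_removable_deletion (find_ok V I) _ _ _. Qed.

Lemma deletion_polynomial (find : finder) :
  finder_polynomial_time find -> vertex_deletion_polynomial_time find.
Proof.
case=> c [k le]; have := poly_bound (poly_add (poly_monomial c k) poly_deletion).
case=> d [l le']; exists d, l => V I start; apply: leq_trans (le' #|V|).
by apply: leq_trans (time_vertex_deletion _ _) _; rewrite leq_add2r.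
Qed.

Lemma tan_polynomial : finder_polynomial_time (@tan).
Proof.
have [c [k le]] := poly_bound poly_tan.
by exists c, k => V I; apply: leq_trans (time_tan I) (le _).
Qed.

Theorem theorem4 :
  (vertex_deletion_polynomial_time (@tan) /\ vertex_deletion_correct (@tan)) /\
  (finds_stable_partitions (@tan) /\ finder_polynomial_time (@tan)) /\
  (forall find : finder,
     finds_stable_partitions find ->
     vertex_deletion_correct find /\
     (finder_polynomial_time find -> vertex_deletion_polynomial_time find)).
Proof.
have tan_ok : finds_stable_partitions (@tan) by move=> V I; apply: tan_stable_partition.
have tan_poly := tan_polynomial.
split; first by split; [apply: deletion_polynomial | apply: deletion_correct].
split=> // find find_ok; split; first exact: deletion_correct.
exact: deletion_polynomial.
Qed.
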